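(* Let $K$ be the completion of a number field at a finite prime and let $\phi$ be a $K$-defined isogeny from $A$ onto $A'$, where $A,A'$ are abelian varieties defined over $K$. Let $L=K(A[\phi])$ and let $L'$ be the maximal unramified extension of $K$ contained in $L$. Let $m$ be the exponent of $A(K)[\phi]$, let $M$ be the unramified extension of $L'$ of degree $m$, and let $\tau$ generate $\mathrm{Gal}(M/K)$. Assume that the group $H^{1}(\mathrm{Gal}(L/L'),A[\phi])$ is trivial. Then the subgroup of $A'(K)/\phi A(K)$ that maps to unramified homomorphisms in $\mathrm{Hom}_{\mathrm{Gal}(L/K)}(\mathrm{Gal}(\overline{L}/L),A[\phi])$ is isomorphic to the group \[ \frac{A(M)[\phi]\cap(\tau-1)A(M)}{(\tau-1)(A(M)[\phi])} \] by the map $P\mapsto \tau Q-Q$, where $P\in A'(K)$, $Q\in A(M)$ and $\phi Q=P$.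
   Context: $A[\phi]$ is the kernel of $\phi$ and $A(F)[\phi]$ its $F$-rational points. The map $A'(K)/\phi A(K)\to \mathrm{Hom}_{\mathrm{Gal}(L/K)}(\mathrm{Gal}(\overline L/L),A[\phi])$ (target: continuous $\mathrm{Gal}(L/K)$-invariant homomorphisms) is the composition of the connecting homomorphism $A'(K)/\phi A(K)\hookrightarrow H^1(\mathrm{Gal}(\overline K/K),A[\phi])$, sending $P$ to the class of $\sigma\mapsto\sigma Q-Q$ with $\phi Q=P$, with restriction to $\mathrm{Gal}(\overline L/L)$. A homomorphism $\mathrm{Gal}(\overline L/L)\to A[\phi]$ is called unramified if it factors through the Galois group of an unramified extension of $L$. *)

(* Defs.v *)
From mathcomp Require Import all_boot all_order all_algebra all_field.
From mathcomp Require Import boolp classical_sets functions reals.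
From mathcomp Require Import mpoly.

Set Implicit Arguments.
Unset Strict Implicit.
Unset Printing Implicit Defensive.
Import Order.TTheory GRing.Theory Num.Theory.
Local Open Scope classical_set_scope.
Local Open Scope ring_scope.

(** * Finite primes of a number field, completions *)

Record nonarch_absv (R : realType) (k : fieldType) (v : k -> R) : Prop := {
  absv_ge0 : forall x, 0 <= v x;
  absv_eq0 : forall x, v x = 0 <-> x = 0;
  absvM : forall x y, v (x * y) = v x * v y;
  absvD : forall x y, v (x + y) <= Num.max (v x) (v y)
}.

(* A finite prime of a number field F is an equivalence class of nontrivial
   non-archimedean absolute values; it is given by a representative. *)
Definition finite_prime (R : realType) (F : fieldExtType rat) (v : F -> R) :=
  nonarch_absv v /\ exists2 x, x != 0 & v x <> 1.

Record is_completion (R : realType) (F K : fieldType) (vF : F -> R)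
    (vK : K -> R) (j : {rmorphism F -> K}) : Prop := {
  compl_absv : nonarch_absv vK;
  compl_ext : forall x, vK (j x) = vF x;
  compl_dense : forall (y : K) (e : R), 0 < e -> exists x, vK (y - j x) < e;
  compl_complete : forall u : nat -> K,
    (forall e : R, 0 < e -> exists N, forall a b,
       (N <= a)%N -> (N <= b)%N -> vK (u a - u b) < e) ->
    exists l, forall e : R, 0 < e -> exists N, forall a,
       (N <= a)%N -> vK (u a - l) < e
}.

(** * Subgroups, quotients *)

Section Quotients.
Variables V W : zmodType.

Definition add_subgroup (G : set V) := G 0 /\ forall x y, G x -> G y -> G (x - y).

Definition add_coset (H : set V) (x : V) : set V := [set x + h | h in H].

Definition quotient_set (G H : set V) : set (set V) := add_coset H @` G.

Definition add_sets (X Y : set V) : set V := [set x + y | x in X & y in Y].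

Definition has_exponent (G : set V) (m : nat) :=
  [/\ (0 < m)%N, forall x, G x -> x *+ m = 0 &
      forall k, (0 < k)%N -> (forall x, G x -> x *+ k = 0) -> (m <= k)%N].

End Quotients.

(* f : G / H -> G' / H' is an isomorphism of groups. *)
Definition quotient_iso (V W : zmodType) (G H : set V) (G' H' : set W)
    (f : set V -> set W) :=
  [/\ add_subgroup G, add_subgroup H & H `<=` G] /\
  [/\ add_subgroup G', add_subgroup H' & H' `<=` G'] /\
  set_bij (quotient_set G H) (quotient_set G' H') f /\
  forall X Y, quotient_set G H X -> quotient_set G H Y ->
    f (add_sets X Y) = add_sets (f X) (f Y).

(** * Subextensions of an algebraic closure and their Galois groups *)

Section Extensions.
Variables (K : fieldType) (Kb : closedFieldType) (iota : {rmorphism K -> Kb}).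

Definition base_field : set Kb := range iota.

Definition subext (E : set Kb) :=
  [/\ base_field `<=` E,
      forall x y, E x -> E y -> E (x - y),
      forall x y, E x -> E y -> E (x * y) &
      forall x, E x -> E x^-1].

Definition has_degree (E N : set Kb) (d : nat) :=
  exists b : 'I_d -> Kb,
  [/\ forall i, N (b i),
      forall x, N x -> exists2 c : 'I_d -> Kb,
        forall i, E (c i) & x = \sum_i c i * b i &
      forall c : 'I_d -> Kb, (forall i, E (c i)) ->
        \sum_i c i * b i = 0 -> forall i, c i = 0].

(* Gal(Kb / E).  When N / E is Galois, Gal(N / E) is the group of restrictions
   to N of the elements of absgal E: below, elements of Gal(N / E) are given by
   lifts to Kb, identified when they agree on N. *)
Definition absgal (E : set Kb) (s : {rmorphism Kb -> Kb}) :=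
  bijective s /\ forall x, E x -> s x = x.

Definition agree_on (N : set Kb) (s t : {rmorphism Kb -> Kb}) :=
  forall x, N x -> s x = t x.

Definition normal_over (E N : set Kb) :=
  forall s, absgal E s -> forall x, N x -> N (s x).

Definition generates_gal (E N : set Kb) (tau : {rmorphism Kb -> Kb}) :=
  absgal E tau /\
  forall s, absgal E s -> exists k, forall x, N x -> s x = iter k tau x.

(* Ramification index 1.  The residue fields of K and of its algebraic
   extensions are algebraic over a finite field when K is a local field, so
   that residue extensions are automatically separable.  The extension N / E
   may be infinite. *)
Definition unramified (R : realType) (v : Kb -> R) (E N : set Kb) :=
  [/\ subext E, subext N, E `<=` N &
      forall x, N x -> exists2 y, E y & v y = v x].

Definition max_unramified (R : realType) (v : Kb -> R) (L L' : set Kb) :=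
  [/\ unramified v base_field L', L' `<=` L &
      forall E, unramified v base_field E -> E `<=` L -> E `<=` L'].

End Extensions.

(** * Projective space and projective varieties *)

(* A point of P^n is given by its unique homogeneous coordinate vector whose
   first nonzero entry is 1; it is rational over a subfield E if and only if
   these normalized coordinates are in E. *)
Definition normalized (k : fieldType) n (x : 'rV[k]_n.+1) :=
  [exists i, (x 0 i == 1) && [forall j : 'I_n.+1, (j < i)%N ==> (x 0 j == 0)]].

Definition ppoint (k : fieldType) n := {x : 'rV[k]_n.+1 | normalized x}.

Definition coords (k : fieldType) n (x : ppoint k n) : 'I_n.+1 -> k :=
  val x 0.

Lemma normalized_map (k : fieldType) n (s : {rmorphism k -> k})
  (x : 'rV[k]_n.+1) : normalized x -> normalized (map_mx s x).
Proof.
case/existsP=> i /andP[/eqP xi /forallP x0]; apply/existsP; exists i.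
rewrite mxE xi rmorph1 eqxx /=; apply/forallP=> j; apply/implyP=> ji.
by rewrite mxE fmorph_eq0; have /implyP := x0 j; apply.
Qed.

Definition ppoint_map (k : fieldType) n (s : {rmorphism k -> k})
  (p : ppoint k n) : ppoint k n := exist _ (map_mx s (val p)) (normalized_map s (valP p)).

Section Varieties.
Variables (k : fieldType) (Kb : closedFieldType) (iota : k -> Kb).

Definition zariski_closed n (V : set (ppoint Kb n)) :=
  exists ps : seq {mpoly k[n.+1]},
    (forall p, p \in ps -> exists d, p \is d.-homog) /\
    V = [set x | forall p, p \in ps -> mmap iota (coords x) p = 0].

(* y is the vector of homogeneous coordinates of q up to a nonzero scalar *)
Definition homog_coords n (q : ppoint Kb n) (y : 'I_n.+1 -> Kb) :=
  exists2 c, c != 0 & forall j, y j = c * coords q j.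

(* f is a morphism defined over k from the image of e to the image of e' *)
Definition regular_map (T T' : Type) n n' (e : T -> ppoint Kb n)
    (e' : T' -> ppoint Kb n') (f : T -> T') :=
  forall P : T, exists (d : nat) (g : 'I_n'.+1 -> {mpoly k[n.+1]}),
  [/\ forall j, g j \is d.-homog,
      exists j, mmap iota (coords (e P)) (g j) != 0 &
      forall Q, (exists j, mmap iota (coords (e Q)) (g j) != 0) ->
        homog_coords (e' (f Q)) (fun j => mmap iota (coords (e Q)) (g j))].

Definition bihomog n n' (d d' : nat) (p : {mpoly k[n.+1 + n'.+1]}) :=
  forall m, m \in msupp p ->
    (\sum_(i < n.+1) m (lshift _ i))%N = d /\
    (\sum_(i < n'.+1) m (rshift _ i))%N = d'.

Definition eval2 n n' (x : ppoint Kb n) (y : ppoint Kb n')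
    (p : {mpoly k[n.+1 + n'.+1]}) : Kb :=
  mmap iota (row_mx (val x) (val y) 0) p.

(* the same, from the product of two projective sets *)
Definition regular_map2 (T1 T2 T' : Type) n1 n2 n' (e1 : T1 -> ppoint Kb n1)
    (e2 : T2 -> ppoint Kb n2) (e' : T' -> ppoint Kb n') (f : T1 -> T2 -> T') :=
  forall (P1 : T1) (P2 : T2),
  exists (d1 d2 : nat) (g : 'I_n'.+1 -> {mpoly k[n1.+1 + n2.+1]}),
  [/\ forall j, bihomog d1 d2 (g j),
      exists j, eval2 (e1 P1) (e2 P2) (g j) != 0 &
      forall Q1 Q2, (exists j, eval2 (e1 Q1) (e2 Q2) (g j) != 0) ->
        homog_coords (e' (f Q1 Q2)) (fun j => eval2 (e1 Q1) (e2 Q2) (g j))].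

End Varieties.

Definition irreducible_set (Kb : closedFieldType) n (V : set (ppoint Kb n)) :=
  V !=set0 /\
  forall X Y : set (ppoint Kb n),
    zariski_closed (@idfun Kb) X -> zariski_closed (@idfun Kb) Y ->
    V `<=` X `|` Y -> V `<=` X \/ V `<=` Y.

(** * Abelian varieties *)

(* An abelian variety over a perfect field K: a geometrically irreducible
   projective variety defined over K whose set of geometric points is a group
   under morphisms defined over K.  The group of geometric points is an
   abstract abelian group with an embedding into projective space. *)
Record abelian_variety (K : fieldType) (Kb : closedFieldType)
    (iota : {rmorphism K -> Kb}) := AbelianVariety {
  av_dim : nat; (* dimension of the ambient projective space *)
  av_pts :> zmodType;
  av_emb : av_pts -> ppoint Kb av_dim;
  av_inj : injective av_emb;
  av_closed : zariski_closed iota (range av_emb);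
  av_irr : irreducible_set (range av_emb);
  av_add : regular_map2 iota av_emb av_emb av_emb +%R;
  av_opp : regular_map iota av_emb av_emb -%R;
  av_zero : forall i, base_field iota (coords (av_emb 0) i)
}.

Section AbelianVarieties.
Variables (K : fieldType) (Kb : closedFieldType) (iota : {rmorphism K -> Kb}).
Implicit Types A : abelian_variety iota.

(* A(E) *)
Definition rational_pts A (E : set Kb) : set A :=
  [set P | forall i, E (coords (av_emb P) i)].

(* Galois action on A(Kb) through the coordinates; the default value of xget is
   never reached for s in Gal(Kb / K), see av_actE. *)
Definition av_act A (s : {rmorphism Kb -> Kb}) (P : A) : A :=
  xget P [set Q : A | av_emb Q = ppoint_map s (av_emb P)].

Lemma av_actE A s (P : A) : absgal (base_field iota) s ->
  av_emb (av_act s P) = ppoint_map s (av_emb P).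
Proof.
case=> _ sK; rewrite /av_act; case: xgetP => [Q _ //|noQ]; exfalso.
have [ps [_ V_def]] := av_closed A.
suff [Q _ QP] : range (@av_emb _ _ _ A) (ppoint_map s (av_emb P)) by apply: (noQ Q).
have : range (@av_emb _ _ _ A) (av_emb P) by exists P.
rewrite V_def /= => P0 p p_ps; rewrite -[RHS](rmorph0 s) -(P0 p p_ps) /mmap.
rewrite rmorph_sum; apply: eq_bigr => m _ /=; rewrite rmorphM /=.
congr (_ * _); first by rewrite sK //; exists p@_m.
by rewrite /mmap1 rmorph_prod; apply: eq_bigr => i _; rewrite rmorphXn /coords mxE.
Qed.

Record isogeny A A' (phi : {additive A -> A'}) : Prop := {
  isog_regular : regular_map iota (@av_emb _ _ _ A) (@av_emb _ _ _ A') phi;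
  isog_onto : forall P : A', exists Q, phi Q = P;
  isog_finite : exists s : seq A, forall Q, phi Q = 0 -> Q \in s
}.

(* A[phi] *)
Definition ker_pts A A' (phi : {additive A -> A'}) : set A :=
  [set P | phi P = 0].

(* A(E)[phi] *)
Definition rational_ker A A' (phi : {additive A -> A'}) (E : set Kb) : set A :=
  rational_pts E `&` ker_pts phi.

(* K(T) : the smallest extension of K over which all points of T are rational *)
Definition adjoin_pts A (T : set A) : set Kb :=
  [set x | forall E, subext iota E -> T `<=` rational_pts E -> E x].

(* H^1(Gal(N / E), T) = 0, for a finite Galois extension N / E and a group of
   points T that are rational over N *)
Definition H1_trivial A (E N : set Kb) (T : set A) :=
  forall c : {rmorphism Kb -> Kb} -> A,
    (forall s, absgal E s -> T (c s)) ->
    (forall s t, absgal E s -> absgal E t -> agree_on N s t -> c s = c t) ->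
    (forall s t, absgal E s -> absgal E t ->
       c (s \o t) = c s + av_act s (c t)) ->
  exists2 a, T a & forall s, absgal E s -> c s = av_act s a - a.

(* Continuous homomorphisms f : Gal(Kb / L) -> T, where T is discrete, that are
   Gal(L / K)-invariant: g f(g^-1 t g) = f(t) for all t and all lifts g of an
   element of Gal(L / K). *)
Record inv_hom A (L : set Kb) (T : set A) (f : {rmorphism Kb -> Kb} -> A) :
    Prop := {
  inv_hom_val : forall s, absgal L s -> T (f s);
  inv_hom_add : forall s t, absgal L s -> absgal L t ->
    f (s \o t) = f s + f t;
  inv_hom_cont : forall s, absgal L s ->
    exists xs : seq Kb, forall t, absgal L t ->
    (forall x, x \in xs -> t x = s x) -> f t = f s;
  inv_hom_inv : forall g s t,
    absgal (base_field iota) g -> absgal L s -> absgal L t ->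
    (forall x, t (g x) = g (s x)) -> f t = av_act g (f s)
}.

(* f factors through Gal(N / L) for some unramified Galois extension N / L *)
Definition unramified_hom A (R : realType) (v : Kb -> R) (L : set Kb)
    (f : {rmorphism Kb -> Kb} -> A) :=
  exists N, [/\ unramified iota v L N, normal_over L N &
    forall s t, absgal L s -> absgal L t -> agree_on N s t -> f s = f t].

(* The cocycle s |-> s Q - Q; its restriction to Gal(Kb / L) depends only on
   phi Q when A[phi] is contained in A(L). *)
Definition kummer A (Q : A) (s : {rmorphism Kb -> Kb}) : A := av_act s Q - Q.

(* The points of A'(K) whose image in Hom_{Gal(L/K)}(Gal(Kb/L), A[phi]) is
   unramified: the preimage in A'(K) of a subgroup of A'(K) / phi A(K). *)
Definition unramified_part A A' (phi : {additive A -> A'}) (R : realType)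
    (v : Kb -> R) (L : set Kb) : set A' :=
  [set P | rational_pts (base_field iota) P /\
    exists Q, [/\ phi Q = P, inv_hom L (ker_pts phi) (kummer Q) &
                  unramified_hom v L (kummer Q)]].

(* (s - 1) T *)
Definition act_sub1 A (s : {rmorphism Kb -> Kb}) (T : set A) : set A :=
  [set av_act s P - P | P in T].

End AbelianVarieties.

(* Main.v *)
Require Import Defs.
From HB Require Import structures.
From mathcomp Require Import all_boot all_order all_algebra all_solvable all_field.
From mathcomp Require Import boolp classical_sets functions reals.
From mathcomp Require Import mpoly ring.
Set Implicit Arguments.
Unset Strict Implicit.
Unset Printing Implicit Defensive.
Import Order.TTheory GRing.Theory Num.Theory.
Local Open Scope classical_set_scope.
Local Open Scope ring_scope.

(** Residue fields do not appear as objects: congruence modulo the maximal ideal of the valuation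
    ring of Kb and the relation x^(p^r) = x stand in for them, and Hensel's lemma is replaced by the
    factorization of X^(p^r) - X into linear factors over Kb. Infinite Galois groups are handled
    through finite orbits of tuples: sums and products over an orbit replace traces and norms, and
    membership in a subfield E is tested by invariance under Gal(Kb/E).

    The approximation by terms e z converges because the values below 1 stay away from 1. In F this
    holds since each element is a root of a rational polynomial of degree at most [F:Q], so that v x
    < 1 forces (v x)^[F:Q] <= v p. Density carries this to K, and the norm carries it to L. Galois
    invariance of v comes from completeness of K through the equivalence of norms on K(x).

    The exponent m and the degree of M / L' meet in the formula s0^k Q = Q + k (s0 Q - Q), where s0
    generates the relevant finite quotient of Gal(U/L'): s0^k is trivial on M only if m divides k,
    and then the last term vanishes. *)

(** Let p be the residue characteristic and U = K(mu') the field generated by the roots of unity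
    of order prime to p.  Absolute values of Kb are invariant under Gal(Kb/K) because K is complete,
    and an extension N/E with the same value group is fixed by the automorphisms over E that fix
    mu', because each element of N is a limit of sums of terms e z with e in E and z in mu'.  So U
    contains M, the intersection of L and U is L', and LU/L is unramified.  Moreover Gal(Kb/K) acts
    on each group of roots of unity through powers of the Frobenius z |-> z^p, so Gal(U/K) is
    procyclic.

    If phi Q = P and the Kummer class of P is unramified on Gal(Kb/L), then on the inertia group
    Gal(Kb/U), whose image in Gal(L/K) is Gal(L/L'), the cocycle s |-> sQ - Q factors through
    Gal(L/L'), and the vanishing of H^1 allows one to translate Q by a point of A[phi] into A(U).
    For s in Gal(Kb/L') the point sQ - Q is then in A(K)[phi], which is killed by m = [M : L'];
    as Gal(U/L') is procyclic, Q is in A(M).  Conversely a point Q of A(M) gives an unramified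
    homomorphism, with N = LU.  Hence both groups are quotients of the group S of the points Q of
    A(M) with phi Q in A'(K): the first through phi, the second through tau - 1. *)

(** * Non-archimedean absolute values *)

Section NonarchAbsv.
Variables (R : realType) (k : fieldType) (v : k -> R).
Hypothesis va : nonarch_absv v.

Lemma absv0 : v 0 = 0. Proof. exact/(absv_eq0 va 0). Qed.

Lemma absv_gt0 x : x != 0 -> 0 < v x.
Proof.
move=> x0; rewrite lt_def absv_ge0 // andbT.
by apply: contra x0 => /eqP /(absv_eq0 va) ->.
Qed.

Lemma absv1 : v 1 = 1.
Proof.
have v1 : v 1 != 0 by rewrite gt_eqF // absv_gt0 ?oner_eq0.
by apply: (mulfI v1); rewrite -(absvM va) !mulr1.
Qed.

Lemma absvX x n : v (x ^+ n) = v x ^+ n.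
Proof. by elim: n => [|n IH]; rewrite ?expr0 ?absv1 // !exprS (absvM va) IH. Qed.

Lemma absvN x : v (- x) = v x.
Proof.
rewrite -mulN1r (absvM va); suff -> : v (-1) = 1 by rewrite mul1r.
apply/eqP; rewrite -(@pexpr_eq1 _ _ 2) ?absv_ge0 // -absvX.
by rewrite expr2 mulrNN mulr1 absv1.
Qed.

Lemma absv_dist x y : v (x - y) = v (y - x).
Proof. by rewrite -absvN opprB. Qed.

Lemma absvV x : v x^-1 = (v x)^-1.
Proof.
have [->|x0] := eqVneq x 0; first by rewrite invr0 absv0 invr0.
have vx : v x != 0 by rewrite gt_eqF ?absv_gt0.
by apply: (mulfI vx); rewrite -(absvM va) !mulfV // absv1.
Qed.

Lemma absvD_le x y c : v x <= c -> v y <= c -> v (x + y) <= c.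
Proof. by move=> xc yc; apply: (le_trans (absvD va x y)); rewrite ge_max xc. Qed.

Lemma absvD_lt x y c : v x < c -> v y < c -> v (x + y) < c.
Proof. by move=> xc yc; apply: (le_lt_trans (absvD va x y)); rewrite gt_max xc. Qed.

Lemma absvB_le x y c : v x <= c -> v y <= c -> v (x - y) <= c.
Proof. by move=> xc yc; apply: absvD_le; rewrite ?absvN. Qed.

Lemma absvB_lt x y c : v x < c -> v y < c -> v (x - y) < c.
Proof. by move=> xc yc; apply: absvD_lt; rewrite ?absvN. Qed.

Lemma absvD_eq x y : v y < v x -> v (x + y) = v x.
Proof.
move=> yx; apply/le_anti/andP; split; first by apply: absvD_le => //; exact: ltW.
rewrite leNgt; apply/negP => h.
have := absvB_lt h yx; rewrite addrK ltxx; exact/negP.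
Qed.

Lemma absv_sum_le I (r : seq I) (P : pred I) (f : I -> k) c : 0 <= c ->
  (forall i, P i -> v (f i) <= c) -> v (\sum_(i <- r | P i) f i) <= c.
Proof.
move=> c0 fc; elim/big_ind: _ => //; first by rewrite absv0.
by move=> x y; apply: absvD_le.
Qed.

Lemma absv_sum_lt I (r : seq I) (P : pred I) (f : I -> k) c : 0 < c ->
  (forall i, P i -> v (f i) < c) -> v (\sum_(i <- r | P i) f i) < c.
Proof.
move=> c0 fc; elim/big_ind: _ => //; first by rewrite absv0.
by move=> x y; apply: absvD_lt.
Qed.

Lemma absv_prod I (r : seq I) (P : pred I) (f : I -> k) :
  v (\prod_(i <- r | P i) f i) = \prod_(i <- r | P i) v (f i).
Proof. exact: (big_morph v (absvM va) absv1). Qed.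

Lemma absv_nat n : v n%:R <= 1.
Proof.
by elim: n => [|n IH]; rewrite ?absv0 // -natr1; apply: absvD_le; rewrite ?absv1.
Qed.

Lemma absvM_le1 x y : v x <= 1 -> v y <= 1 -> v (x * y) <= 1.
Proof. by move=> x1 y1; rewrite (absvM va) mulr_ile1 // (absv_ge0 va). Qed.

Lemma absvM_lt1 x y : v x < 1 -> v y <= 1 -> v (x * y) < 1.
Proof.
move=> x1 y1; rewrite (absvM va); apply: le_lt_trans x1.
by rewrite ler_piMr // (absv_ge0 va).
Qed.

Lemma absvX_le1 x n : v x <= 1 -> v (x ^+ n) <= 1.
Proof. by move=> x1; rewrite absvX exprn_ile1 // (absv_ge0 va). Qed.

Lemma absvX_lt1 x n : (0 < n)%N -> (v (x ^+ n) < 1) = (v x < 1).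
Proof. by move=> n0; rewrite absvX expr_lt1 // (absv_ge0 va). Qed.

(** This extracts, from the smallness of a split monic polynomial at x, a root congruent to x. *)
Lemma absv_prod_lt1 (r : seq k) (x : k) :
  v (\prod_(y <- r) (x - y)) < 1 -> exists2 y, y \in r & v (x - y) < 1.
Proof.
elim: r => [|a r IH]; first by rewrite big_nil absv1 ltxx.
rewrite big_cons (absvM va) => h.
have [xa|ax] := ltP (v (x - a)) 1; first by exists a; rewrite ?mem_head.
have [|y yr xy] := IH; last by exists y; rewrite // inE yr orbT.
by apply: le_lt_trans h; rewrite ler_peMl // (absv_ge0 va).
Qed.

(* Congruence modulo the maximal ideal of the valuation ring *)
Definition vcong x y := v (x - y) < 1.

Lemma vcong_refl x : vcong x x.
Proof. by rewrite /vcong subrr absv0. Qed.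

Lemma vcong_sym x y : vcong x y -> vcong y x.
Proof. by rewrite /vcong absv_dist. Qed.

Lemma vcong_trans y x z : vcong x y -> vcong y z -> vcong x z.
Proof. by rewrite /vcong => xy yz; rewrite -(subrKA y) absvD_lt. Qed.

Lemma vcongD x y x' y' : vcong x x' -> vcong y y' -> vcong (x + y) (x' + y').
Proof. by rewrite /vcong => xx yy; rewrite opprD addrACA absvD_lt. Qed.

Lemma vcongN x x' : vcong x x' -> vcong (- x) (- x').
Proof. by rewrite /vcong => xx; rewrite -opprD absvN. Qed.

Lemma vcongB x y x' y' : vcong x x' -> vcong y y' -> vcong (x - y) (x' - y').
Proof. by move=> xx yy; apply: vcongD => //; apply: vcongN. Qed.

Lemma vcong_sum I (r : seq I) (P : pred I) (f g : I -> k) :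
  (forall i, P i -> vcong (f i) (g i)) ->
  vcong (\sum_(i <- r | P i) f i) (\sum_(i <- r | P i) g i).
Proof. by move=> fg; rewrite /vcong -sumrB; apply: absv_sum_lt. Qed.

Lemma vcong_le1 x y : vcong x y -> v x <= 1 -> v y <= 1.
Proof.
by move=> xy x1; rewrite -(subrK x y) absvD_le // absv_dist; apply: ltW.
Qed.

Lemma vcong_lt1 x y : vcong x y -> v x < 1 -> v y < 1.
Proof. by move=> xy x1; rewrite -(subrK x y) absvD_lt // absv_dist. Qed.

Lemma vcong_eq1 x y : vcong x y -> v x = 1 -> v y = 1.
Proof.
move=> xy x1; rewrite -(subrK x y) addrC absvD_eq // x1 absv_dist //.
Qed.

Lemma vcongM x y x' y' : v x <= 1 -> v y' <= 1 ->
  vcong x x' -> vcong y y' -> vcong (x * y) (x' * y').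
Proof.
rewrite /vcong => x1 y1 xx yy.
have -> : x * y - x' * y' = (y - y') * x + (x - x') * y'.
  by rewrite !mulrBl (mulrC y) (mulrC y') -!addrA addKr.
by rewrite absvD_lt ?absvM_lt1.
Qed.

Lemma vcongX x y n : v x <= 1 -> vcong x y -> vcong (x ^+ n) (y ^+ n).
Proof.
move=> x1 xy; elim: n => [|n IH]; first by rewrite !expr0 vcong_refl.
by rewrite !exprS vcongM // absvX_le1 //; apply: vcong_le1 xy x1.
Qed.

(** * Frobenius congruences and Teichmüller representatives *)

Section ResidueChar.
Variable p : nat.
Hypotheses (p_prime : prime p) (vp : v p%:R < 1).

Lemma absv_dvdn n : (p %| n)%N -> v n%:R < 1.
Proof. by case/dvdnP => m ->; rewrite mulnC natrM absvM_lt1 ?absv_nat. Qed.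

Lemma absv_ndvdn n : ~~ (p %| n)%N -> v n%:R = 1.
Proof.
move=> pn; apply/le_anti; rewrite absv_nat leNgt /=; apply/negP => nv.
have n0 : (0 < n)%N by case: n pn {nv} => //; rewrite dvdn0.
have [a] := Bezoutl p n0; rewrite gcdnC (_ : gcdn p n = 1%N); last first.
  by apply/eqP; rewrite -/(coprime p n) prime_coprime.
move=> _ /dvdnP [b] /(congr1 (fun n => n%:R : k)); rewrite natrD !natrM => e.
have : v 1 < 1.
  have -> : 1 = b%:R * n%:R - a%:R * p%:R :> k by rewrite -e addrK.
  by apply: absvB_lt; rewrite mulrC absvM_lt1 ?absv_nat.
by rewrite absv1 ltxx.
Qed.

(** The inner binomial coefficients are divisible by p, so only the two extreme terms survive. *)
Lemma vcong_frobD x y : v x <= 1 -> v y <= 1 ->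
  vcong ((x + y) ^+ p) (x ^+ p + y ^+ p).
Proof.
move=> x1 y1; rewrite /vcong exprDn; case: p p_prime vp => // q q_prime vq.
rewrite big_ord_recl big_ord_recr /= bin0 subn0 expr0 mulr1 mulr1n /bump /=.
rewrite add1n subnn expr0 mul1r binn mulr1n opprD addrACA subrr add0r addrK.
apply: absv_sum_lt => // i _; rewrite -mulr_natl absvM_lt1 //.
  apply: le_lt_trans vq; rewrite /bump /=.
  have /dvdnP [m ->] : (q.+1 %| 'C(q.+1, 1 + i))%N by rewrite prime_dvd_bin //=; rewrite add1n ltnS.
  by rewrite natrM (absvM va) ler_piMl ?absv_nat // (absv_ge0 va).
by rewrite absvM_le1 ?absvX_le1.
Qed.

Lemma vcong_frobXD r x y : v x <= 1 -> v y <= 1 ->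
  vcong ((x + y) ^+ (p ^ r)) (x ^+ (p ^ r) + y ^+ (p ^ r)).
Proof.
move=> x1 y1; elim: r => [|r IH]; first by rewrite expn0 !expr1 vcong_refl.
rewrite expnSr !exprM; apply: vcong_trans (vcong_frobD _ _); rewrite ?absvX_le1 //.
by apply: vcongX => //; rewrite absvX_le1 // absvD_le.
Qed.

(** Additivity applied to x + (-x) = 0 treats p = 2 together with odd p. *)
Lemma vcong_frobXN r x : v x <= 1 -> vcong ((- x) ^+ (p ^ r)) (- x ^+ (p ^ r)).
Proof.
move=> x1; have := @vcong_frobXD r x (- x) x1; rewrite absvN => /(_ x1).
rewrite subrr expr0n expn_eq0 (gtn_eqF (prime_gt0 p_prime)) /= => h.
have := vcongB (vcong_sym h) (vcong_refl (x ^+ (p ^ r))).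
by rewrite addrC addKr sub0r.
Qed.

Lemma vcong_frobXB r x y : v x <= 1 -> v y <= 1 ->
  vcong ((x - y) ^+ (p ^ r)) (x ^+ (p ^ r) - y ^+ (p ^ r)).
Proof.
move=> x1 y1; apply: vcong_trans (vcongD (vcong_refl _) (vcong_frobXN r y1)).
by apply: vcong_frobXD; rewrite ?absvN.
Qed.

Lemma vcong_frob_sum I (s : seq I) (P : pred I) (f : I -> k) r :
  (forall i, P i -> v (f i) <= 1) ->
  vcong ((\sum_(i <- s | P i) f i) ^+ (p ^ r)) (\sum_(i <- s | P i) f i ^+ (p ^ r)).
Proof.
move=> f1; elim: s => [|a s IH].
  by rewrite !big_nil expr0n expn_eq0 (gtn_eqF (prime_gt0 p_prime)) vcong_refl.
rewrite !big_cons; case: ifP => // Pa.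
apply: vcong_trans (vcongD (vcong_refl _) IH); apply: vcong_frobXD; first exact: f1.
by apply: absv_sum_le.
Qed.

(** The p^r-th power of x - y is congruent to the difference of the powers, and a power is small
    only if its base is. *)
Lemma vcong_frob_inj r x y : v x <= 1 -> v y <= 1 ->
  vcong (x ^+ (p ^ r)) (y ^+ (p ^ r)) -> vcong x y.
Proof.
move=> x1 y1 h; have := vcong_lt1 (vcong_sym (vcong_frobXB r x1 y1)) h.
by rewrite absvX_lt1 // expn_gt0 prime_gt0.
Qed.

Lemma vcong_nat_fermat n : vcong (n%:R ^+ p) n%:R.
Proof.
elim: n => [|n IH].
  by rewrite expr0n (gtn_eqF (prime_gt0 p_prime)) vcong_refl.
rewrite -natr1; have := @vcong_frobD n%:R 1; rewrite absv_nat absv1 => /(_ _ _)/vcong_trans -> //.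
by rewrite expr1n; apply: vcongD => //; apply: vcong_refl.
Qed.

Lemma expr_frob_iter r i (x : k) : x ^+ (p ^ r) = x -> x ^+ (p ^ (r * i)) = x.
Proof.
by move=> xr; elim: i => [|i IH]; rewrite ?muln0 // mulnS expnD exprM xr.
Qed.

(** The solutions of z^(p^r) = z, namely 0 and the roots of unity of order dividing p^r - 1, serve
    as Teichmüller representatives of residue classes. *)
Lemma teich_le1 r z : (0 < r)%N -> z ^+ (p ^ r) = z -> v z <= 1.
Proof.
move=> r0 zr; rewrite leNgt; apply/negP => vz.
have : v z < v (z ^+ (p ^ r)); last by rewrite zr ltxx.
by rewrite absvX ltr_eXnr // -(exp1n r) ltn_exp2r // prime_gt1.
Qed.

(** With q = p^r, the quotient of z^q - z'^q by z - z' is congruent to q z'^(q-1), which is small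
    because p divides q. *)
Lemma teich_inj r z z' : (0 < r)%N -> z ^+ (p ^ r) = z -> z' ^+ (p ^ r) = z' ->
  vcong z z' -> z = z'.
Proof.
move=> r0 zr z'r zz'.
have q1 : (1 < p ^ r)%N by rewrite -(exp1n r) ltn_exp2r // prime_gt1.
have vz := teich_le1 r0 zr; have vz' := teich_le1 r0 z'r.
(* Otherwise z - z' = z^q - z'^q is the product of z - z' and a sum of value < 1. *)
apply/eqP; rewrite -subr_eq0; apply/negP => /negP zz.
have : v (z - z') < v (z - z'); last by rewrite ltxx.
rewrite -{1}zr -{1}z'r subrXX (absvM va) gtr_pMr ?absv_gt0 //.
have : vcong (\sum_(i < p ^ r) z ^+ ((p ^ r).-1 - i) * z' ^+ i)
             (\sum_(i < p ^ r) z' ^+ (p ^ r).-1).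
  apply: vcong_sum => i _.
  have {2}-> : (p ^ r).-1 = ((p ^ r).-1 - i + i)%N.
    by rewrite subnK // -ltnS prednK // (ltn_trans _ q1).
  by rewrite exprD; apply: vcongM; rewrite ?absvX_le1 ?vcong_refl //; apply: vcongX.
rewrite sumr_const card_ord => /vcong_sym /vcong_lt1; apply.
by rewrite -mulr_natl absvM_lt1 ?absvX_le1 // absv_dvdn // dvdn_exp.
Qed.
End ResidueChar.
End NonarchAbsv.

(** * Extension of embeddings and fixed fields *)

Section Galois.
Variables (K : fieldType) (Kb : closedFieldType) (iota : {rmorphism K -> Kb}).
Hypothesis Kb_alg : forall x, algebraicOver iota x.

(** Factors X are removed from an annihilating polynomial until its constant term is nonzero; the
    relation is then divided by x. Hence subrings of Kb containing K are fields, and [partial_mor]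
    needs no clause for inverses. *)
Lemma algebraic_inv_poly x : x != 0 -> exists f : {poly K}, x^-1 = (map_poly iota f).[x].
Proof.
move=> x0; have [p + /rootP] := Kb_alg x.
elim/poly_ind: p => [|p c IH]; first by rewrite eqxx.
rewrite rmorphD rmorphM /= map_polyX map_polyC /= !hornerE.
have [->|c0 _ e] := eqVneq c 0.
  rewrite addr0 rmorph0 addr0 => p0 /eqP; rewrite mulf_eq0 (negPf x0) orbF => /eqP.
  by apply: IH; apply: contra p0 => /eqP ->; rewrite mul0r.
exists (- c^-1 *: p); rewrite map_polyZ hornerZ /=.
have ic0 : iota c != 0 by rewrite fmorph_eq0.
have {}e : (map_poly iota p).[x] * x = - iota c by apply/eqP; rewrite -addr_eq0 e.
apply: (mulIf x0); rewrite mulVf // -mulrA e.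
by rewrite rmorphN fmorphV mulrN mulNr opprK mulVf.
Qed.

(* Graph of a K-morphism from a subring of Kb (hence from a subfield) to Kb. *)
Record partial_mor (S : set (Kb * Kb)) : Prop := {
  pmor_base : forall a, S (iota a, iota a);
  pmorB : forall x y, S x -> S y -> S (x - y);
  pmorM : forall x y, S x -> S y -> S (x * y);
  pmor_fun : forall b, S (0, b) -> b = 0
}.

Section PartialMor.
Variables (S : set (Kb * Kb)) (Sm : partial_mor S).

Lemma pmor1 : S (1, 1).
Proof. by have := pmor_base Sm 1; rewrite rmorph1. Qed.

Lemma pmor0 : S (0, 0).
Proof. by have := pmor_base Sm 0; rewrite rmorph0. Qed.

Lemma pmorD x y : S x -> S y -> S (x + y).
Proof.
move=> Sx Sy; rewrite -[y]opprK; apply: pmorB => //.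
by rewrite -sub0r; apply: pmorB => //; apply: pmor0.
Qed.

Lemma pmor_sum I (r : seq I) (P : pred I) (f g : I -> Kb) :
  (forall i, P i -> S (f i, g i)) ->
  S (\sum_(i <- r | P i) f i, \sum_(i <- r | P i) g i).
Proof.
move=> h; elim: r => [|a r IH]; rewrite ?big_nil ?big_cons; first exact: pmor0.
by case: ifP => // Pa; apply: (@pmorD (f a, g a) (_, _)) => //; apply: h.
Qed.

Lemma pmorX a b n : S (a, b) -> S (a ^+ n, b ^+ n).
Proof.
move=> ab; elim: n => [|n IH]; first exact: pmor1.
by rewrite !exprS; apply: (@pmorM _ Sm (a, b) (_, _)).
Qed.

Lemma pmor_horner (f : {poly K}) a b : S (a, b) ->
  S ((map_poly iota f).[a], (map_poly iota f).[b]).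
Proof.
move=> ab; rewrite !horner_coef; apply: pmor_sum => i _; rewrite coef_map.
by apply: (@pmorM _ Sm (_, _) (_, _)); [apply: pmor_base | apply: pmorX].
Qed.

Lemma pmorV a b : S (a, b) -> a != 0 -> exists c, S (a^-1, c).
Proof.
by move=> ab /algebraic_inv_poly [f ->]; exists (map_poly iota f).[b]; apply: pmor_horner.
Qed.

Lemma pmor_uniq a b c : S (a, b) -> S (a, c) -> b = c.
Proof.
move=> ab ac; apply/subr0_eq/(pmor_fun Sm).
by have : S (a - a, b - c) := pmorB Sm ab ac; rewrite subrr.
Qed.

Lemma pmor_inj a : S (a, 0) -> a = 0.
Proof.
move=> a0; apply/eqP; apply: contraT => an0; have [c ac] := pmorV a0 an0.
have : S (a^-1 * a, c * 0) := pmorM Sm ac a0; rewrite mulVf // mulr0 => /pmor_uniq/(_ pmor1)/esym/eqP.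
by rewrite oner_eq0.
Qed.

Definition pmor_poly (f g : {poly Kb}) := forall i, S (f`_i, g`_i).

(** Here f is a minimal polynomial of x over the domain of S, not made monic, and f' is its
    transport along S. *)
Lemma pmor_poly_min x : exists f f', [/\ pmor_poly f f', f != 0, root f x &
  forall g g', pmor_poly g g' -> g != 0 -> root g x -> (size f <= size g)%N].
Proof.
pose Q n := `[< exists f f', [/\ pmor_poly f f', f != 0, root f x & size f = n] >].
have exQ : exists n, Q n.
  have [p p0 px] := Kb_alg x; exists (size (map_poly iota p)); apply/asboolP.
  exists (map_poly iota p), (map_poly iota p); split => //; last by rewrite map_poly_eq0.
  by move=> i; rewrite coef_map; apply: pmor_base.
case: (ex_minnP exQ) => n /asboolP [f [f' [ff' f0 fx sf]]] min.
exists f, f'; split => // g g' gg' g0 gx; rewrite sf; apply: min.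
by apply/asboolP; exists g, g'.
Qed.

Definition pmor_adjoin x y : set (Kb * Kb) :=
  [set z | exists g g', [/\ pmor_poly g g', z.1 = g.[x] & z.2 = g'.[y]]].

Lemma sub_pmor_adjoin x y : S `<=` pmor_adjoin x y.
Proof.
move=> [a b] ab; exists a%:P, b%:P; rewrite !hornerC; split=> // i.
by rewrite !coefC; case: eqP => _ //; apply: pmor0.
Qed.

Lemma mem_pmor_adjoin x y : pmor_adjoin x y (x, y).
Proof.
exists 'X, 'X; rewrite !hornerX; split=> // i; rewrite !coefX.
by case: eqP => _; [apply: pmor1 | apply: pmor0].
Qed.

(** The point is that g(x) = 0 implies g'(y) = 0. Division of g by f is performed one leading term
    at a time, simultaneously on the transported pair (g', f'); minimality of f rules out a nonzero
    remainder. *)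
Lemma pmor_adjoin_mor x y f f' : pmor_poly f f' -> f != 0 -> root f x ->
  (forall g g', pmor_poly g g' -> g != 0 -> root g x -> (size f <= size g)%N) ->
  root f' y -> partial_mor (pmor_adjoin x y).
Proof.
move=> ff' f0 fx min f'y.
have [l lP] : exists l, S ((lead_coef f)^-1, l).
  by apply: (pmorV (ff' _)); rewrite -lead_coefE lead_coef_eq0.
split.
- by move=> a; apply: sub_pmor_adjoin; apply: (pmor_base Sm).
- move=> [a b] [a' b'] [g [g' [gg' /= -> ->]]] [h [h' [hh' /= -> ->]]].
  exists (g - h), (g' - h'); rewrite !hornerE; split=> // i.
  by rewrite !coefB; apply: (pmorB Sm (gg' i) (hh' i)).
- move=> [a b] [a' b'] [g [g' [gg' /= -> ->]]] [h [h' [hh' /= -> ->]]].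
  exists (g * h), (g' * h'); rewrite !hornerE; split=> // i.
  by rewrite !coefM; apply: pmor_sum => j _; apply: (pmorM Sm (gg' _) (hh' _)).
move=> b [g [g' [gg' /= /esym/rootP]]]; move: {2}(size g) (leqnn (size g)) => n.
elim: n g g' gg' b => [|n IH] g g' gg' b.
  rewrite leqn0 size_poly_eq0 => /eqP g0 _ ->.
  suff -> : g' = 0 by rewrite horner0.
  by apply/polyP => i; rewrite coef0; apply: (pmor_fun Sm); have := gg' i; rewrite g0 coef0.
move=> sg gx ->.
have [g0|g0] := eqVneq g 0.
  by apply: (IH g g' gg'); rewrite // g0 size_poly0.
have fg := min _ _ gg' g0 gx.
have f_gt0 : (0 < size f)%N by rewrite lt0n size_poly_eq0.
(* The multiple c X^k f cancels the coefficient of X^n in g; c' is the image of c, with [l] the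
   image of the inverse leading coefficient of f. *)
pose k := (n.+1 - size f)%N; pose c := g`_n * (lead_coef f)^-1; pose c' := g'`_n * l.
have cc' : S (c, c') by apply: (pmorM Sm (gg' n) lP).
have := IH (g - c *: ('X^k * f)) (g' - c' *: ('X^k * f')) _ g'.[y].
rewrite hornerD hornerN hornerZ hornerM (rootP f'y) !mulr0 subr0; apply=> //.
- move=> i; have kf : S (('X^k * f)`_i, ('X^k * f')`_i).
    by rewrite !coefXnM; case: ifP => _; [apply: pmor0 | apply: ff'].
  rewrite !coefB !coefZ; exact: (pmorB Sm (gg' i) (pmorM Sm cc' kf)).
- apply/leq_sizeP => j nj; rewrite coefB coefZ coefXnM.
  have fn : (size f <= n.+1)%N by apply: leq_trans fg sg.
  have kj : (k <= j)%N by rewrite (leq_trans _ nj) // /k leq_subLR -add1n leq_add2r.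
  rewrite ltnNge kj /=; move: nj; rewrite leq_eqVlt => /orP [/eqP <-|nj].
    have -> : (n - k = (size f).-1)%N.
      by rewrite /k -[size f in LHS]prednK // subSS subKn // -ltnS prednK.
    by rewrite -lead_coefE /c divfK ?subrr // lead_coef_eq0.
  rewrite [g`_j]nth_default ?(leq_trans sg) // [f`_(j - k)]nth_default ?mulr0 ?subr0 //.
  by rewrite leq_subRL // /k subnK.
- by apply/rootP; rewrite hornerD hornerN hornerZ hornerM (rootP fx) (rootP gx) !mulr0 subr0.
Qed.

Lemma pmor_poly_root x f f' : pmor_poly f f' -> f != 0 -> root f x ->
  exists y, root f' y.
Proof.
move=> ff' f0 fx; apply/closed_rootP.
have sf : (1 < size f)%N by apply: root_size_gt1 fx.
apply: contraTneq sf => sf'; rewrite -leqNgt; apply/leq_sizeP => j j1.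
by apply: pmor_inj; have := ff' j; rewrite [f'`_j]nth_default ?sf'.
Qed.
End PartialMor.

Lemma pmor_extend (S : set (Kb * Kb)) : partial_mor S ->
  exists s : {rmorphism Kb -> Kb}, forall x y, S (x, y) -> s x = y.
Proof.
(* Zorn's lemma is applied to the part added to S, so that the empty chain, whose union is empty,
   also has an admissible union. *)
move=> Sm; pose P X := partial_mor (S `|` X).
have [|X [PX Xmax]] := @Zorn_bigcup _ P.
  move=> F FP Ftot; rewrite /P; have [->|/set0P [X0 FX0]] := eqVneq F set0; first by rewrite bigcup_set0 setU0.
  have pick2 x y : (S `|` \bigcup_(X in F) X) x -> (S `|` \bigcup_(X in F) X) y ->
      exists X, [/\ F X, (S `|` X) x & (S `|` X) y].
    case=> [Sx|[X FX Xx]] [Sy|[Y FY Yy]].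
    - by exists X0; split=> //; left.
    - by exists Y; split=> //; [left|right].
    - by exists X; split=> //; [right|left].
    - have [XY|YX] := Ftot X Y FX FY.
        by exists Y; split=> //; right; [apply: XY|].
      by exists X; split=> //; right; [|apply: YX].
  have back X x : F X -> (S `|` X) x -> (S `|` \bigcup_(X in F) X) x.
    by move=> FX [Sx|Xx]; [left|right; exists X].
  split.
  - by move=> a; left; apply: pmor_base.
  - move=> x y Hx Hy; have [X [FX Xx Xy]] := pick2 x y Hx Hy.
    by apply: (back X) => //; apply: pmorB => //; apply: FP.
  - move=> x y Hx Hy; have [X [FX Xx Xy]] := pick2 x y Hx Hy.
    by apply: (back X) => //; apply: pmorM => //; apply: FP.
  - move=> b Hb; have [X [FX Xx _]] := pick2 _ _ Hb Hb.
    exact: (pmor_fun (FP _ FX)).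
set T := S `|` X in PX; have Tm : partial_mor T := PX.
have dom x : exists y, T (x, y).
  have [f [f' [ff' f0 fx min]]] := pmor_poly_min Tm x.
  have [y f'y] := pmor_poly_root Tm ff' f0 fx.
  have Am := pmor_adjoin_mor Tm ff' f0 fx min f'y.
  have TA := @sub_pmor_adjoin _ Tm x y.
  have Axy := mem_pmor_adjoin Tm x y.
  set A := pmor_adjoin _ _ _ in Am TA Axy.
  have SA : S `|` A = A by apply/setUidPr => z Sz; apply: TA; left.
  have [Xxy|Xxy] := EM (X (x, y)); first by exists y; right.
  (* A maximal morphism is total: otherwise x could be adjoined with a root y of the transported
     minimal polynomial as its image. *)
  exfalso; apply: (Xmax A); last by rewrite /P SA.
  split; first by move=> z Xz; apply: TA; right.
  by move=> AX; apply: Xxy; apply: AX.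
have [s sP] := choice dom.
have sE x y : T (x, y) -> s x = y by apply: pmor_uniq (sP x).
have s_zmod : zmod_morphism s.
  by move=> x y; apply: sE; apply: (pmorB Tm (sP x) (sP y)).
have s_mon : monoid_morphism s.
  split; first by apply: sE; apply: pmor1.
  by move=> x y; apply: sE; apply: (pmorM Tm (sP x) (sP y)).
pose sz := GRing.isZmodMorphism.Build Kb Kb s s_zmod.
pose sm := GRing.isMonoidMorphism.Build Kb Kb s s_mon.
pose sr : {rmorphism Kb -> Kb} := HB.pack s sz sm.
by exists sr => x y Sxy; apply: sE; left.
Qed.

End Galois.

(** * Automorphisms of Kb over K, fixed fields and finite orbits *)

Section FixedFields.
Variables (K : fieldType) (Kb : closedFieldType) (iota : {rmorphism K -> Kb}).
Hypothesis Kb_alg : forall x, algebraicOver iota x.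
Local Notation auto := {rmorphism Kb -> Kb}.
Implicit Types (E : set Kb) (s t : auto).

Lemma absgal_sub E E' s : E `<=` E' -> absgal E' s -> absgal E s.
Proof. by move=> EE [s_bij sE]; split=> // x /EE; apply: sE. Qed.

Lemma absgal_id E : absgal E (idfun : auto).
Proof. by split=> //; exists id. Qed.

Lemma absgal_comp E s t : absgal E s -> absgal E t -> absgal E (s \o t : auto).
Proof.
move=> [bs sE] [bt tE]; split; first exact: bij_comp.
by move=> x Ex /=; rewrite tE ?sE.
Qed.

Lemma absgal_inv E s : absgal E s ->
  exists t, [/\ absgal E t, cancel s t & cancel t s].
Proof.
move=> [[t st ts] sE].
pose tz := GRing.isZmodMorphism.Build Kb Kb t (can2_zmod_morphism st ts).
pose tm := GRing.isMonoidMorphism.Build Kb Kb t (can2_monoid_morphism st ts).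
pose tr : auto := HB.pack t tz tm.
exists tr; split=> //; split; first by exists s.
by move=> x Ex; rewrite -{1}(sE x Ex); apply: st.
Qed.

Lemma absgal_iter E s n : absgal E s ->
  exists t, absgal E t /\ forall x, t x = iter n s x.
Proof.
move=> sE; elim: n => [|n [t [tE tP]]]; first by exists idfun; split=> //; apply: absgal_id.
by exists (s \o t : auto); split=> [|x] /=; [apply: absgal_comp | rewrite tP].
Qed.

Lemma root_rmorph s (p : {poly K}) x : (forall a, s (iota a) = iota a) ->
  root (map_poly iota p) x -> root (map_poly iota p) (s x).
Proof.
move=> sK; rewrite -(fmorph_root s) -map_poly_comp; congr (is_true (root _ _)).
by apply/polyP => i; rewrite !coef_map; apply: sK.
Qed.

Lemma finite_conj x : exists r : seq Kb, forall s, absgal (base_field iota) s -> s x \in r.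
Proof.
have [p p0 px] := Kb_alg x.
have [r Dp] := closed_field_poly_normal (map_poly iota p).
exists r => s [_ sK]; have := root_rmorph (s := s) _ px; rewrite Dp.
rewrite rootZ ?lead_coef_eq0 ?map_poly_eq0 // root_prod_XsubC; apply=> a.
by apply: sK; exists a.
Qed.

(** Being injective, s permutes the finite set of roots of a polynomial over K that annihilates y,
    so y is attained. *)
Lemma rmorph_bij s : (forall a, s (iota a) = iota a) -> bijective s.
Proof.
move=> sK; suff s_surj y : exists x, s x = y.
  have [t tP] := choice s_surj.
  by exists t => // x; apply: (fmorph_inj s); rewrite tP.
have [p p0 py] := Kb_alg y.
have [r Dp] := closed_field_poly_normal (map_poly iota p).
have rE z : (z \in undup r) = root (map_poly iota p) z.
  by rewrite mem_undup Dp rootZ ?lead_coef_eq0 ?map_poly_eq0 // root_prod_XsubC.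
have sub : {subset map s (undup r) <= undup r}.
  by move=> _ /mapP [z zr ->]; rewrite rE root_rmorph // -rE.
have us : uniq (map s (undup r)) by rewrite map_inj_uniq ?undup_uniq //; apply: fmorph_inj.
have [_ rs] := uniq_min_size us sub (eq_leq (esym (size_map _ _))).
by have := rE y; rewrite py -rs => /mapP [x _ ->]; exists x.
Qed.

Section Subext.
Variables (E : set Kb) (Es : subext iota E).

Lemma subext_base a : E (iota a).
Proof. by case: Es => + _ _ _; apply; exists a. Qed.

Lemma subextB x y : E x -> E y -> E (x - y).
Proof. by case: Es => _ + _ _; apply. Qed.

Lemma subextM x y : E x -> E y -> E (x * y).
Proof. by case: Es => _ _ + _; apply. Qed.

Lemma subextV x : E x -> E x^-1.
Proof. by case: Es => _ _ _; apply. Qed.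

Lemma subext_nat n : E n%:R.
Proof. by rewrite -(rmorph_nat iota); apply: subext_base. Qed.

Lemma subextN x : E x -> E (- x).
Proof. by rewrite -sub0r => Ex; apply: subextB => //; apply: (subext_nat 0). Qed.

Lemma subextD x y : E x -> E y -> E (x + y).
Proof. by move=> Ex Ey; rewrite -[y]opprK; apply: subextB => //; apply: subextN. Qed.

Lemma pmor_diag : partial_mor iota [set z | E z.1 /\ z.1 = z.2].
Proof.
split=> [a|[a b] [c d] /= [Ea <-] [Ec <-]|[a b] [c d] /= [Ea <-] [Ec <-]|b /= [_ <-] //].
- by split=> //=; apply: subext_base.
- by split=> //=; apply: subextB.
- by split=> //=; apply: subextM.
Qed.
End Subext.

Lemma subext_base_field : subext iota (base_field iota).
Proof.
split=> //.
- by move=> _ _ [a _ <-] [b _ <-]; exists (a - b); rewrite ?rmorphB.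
- by move=> _ _ [a _ <-] [b _ <-]; exists (a * b); rewrite ?rmorphM.
- by move=> _ [a _ <-]; exists (a^-1); rewrite ?fmorphV.
Qed.

Lemma base_sub_subext E : subext iota E -> base_field iota `<=` E.
Proof. by case. Qed.

Lemma subext_fixed (G : set auto) : (forall s, G s -> absgal (base_field iota) s) ->
  subext iota [set x | forall s, G s -> s x = x].
Proof.
move=> GK; split.
- by move=> _ [a _ <-] s /GK [_]; apply; exists a.
- by move=> x y xf yf s Gs; rewrite rmorphB xf ?yf.
- by move=> x y xf yf s Gs; rewrite rmorphM xf ?yf.
- by move=> x xf s Gs; rewrite fmorphV xf.
Qed.

Hypothesis K_char0 : [pchar K] =i pred0.

Lemma Kb_char0 : [pchar Kb] =i pred0.
Proof. by move=> p; rewrite (fmorph_pchar iota). Qed.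

(** If x is not in E, its minimal polynomial over E is separable in characteristic 0 and has a
    second root y; the E-morphism sending x to y extends to an automorphism of Kb that moves x. *)
Lemma fixed_absgal E x : subext iota E -> (forall s, absgal E s -> s x = x) -> E x.
Proof.
move=> Es fx; apply: contrapT => Ex.
have Sm := pmor_diag Es; set S := [set _ | _] in Sm.
have [f [f' [ff' f0 rfx min]]] := pmor_poly_min Kb_alg Sm x.
have Ef i : E f`_i by case: (ff' i).
have fE (g : {poly Kb}) : (forall i, E g`_i) -> g != 0 -> root g x -> (size f <= size g)%N.
  by move=> gE; apply: min => i; split=> //=; apply: gE.
have sf : (1 < size f)%N by apply: root_size_gt1 rfx.
have df0 : f^`() != 0.
  apply/eqP => /(congr1 (fun g : {poly Kb} => g`_(size f).-2)); rewrite coef_deriv coef0.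
  case: (size f) sf (lead_coefE f) => [|[|n]] // _ /= <- /eqP.
  by rewrite -mulr_natr mulf_eq0 lead_coef_eq0 (negPf f0) ((pcharf0P _).1 Kb_char0).
have df : ~~ root f^`() x.
  apply/negP => dfx; suff : (size f <= size f^`())%N by rewrite leqNgt lt_size_deriv.
  by apply: fE => // i; rewrite coef_deriv -mulr_natr; apply: subextM => //; apply: subext_nat.
have /factor_theorem [g fg] := rfx.
have gx : ~~ root g x.
  apply: contra df => /rootP gx; rewrite fg derivM derivXsubC mulr1.
  by apply/rootP; rewrite hornerD hornerM gx hornerXsubC subrr mulr0 addr0.
have g0 : g != 0 by apply: contraNneq gx => ->; apply: root0.
have [y gy] : exists y, root g y.
  (* A cofactor g without roots is constant; then f is linear over E and x lies in E. *)
  apply/closed_rootP; apply: contra_notN Ex => /eqP sg.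
  have sf2 : size f = 2 by rewrite fg size_Mmonic ?monicXsubC // size_XsubC sg.
  have : f.[x] = 0 by apply/rootP.
  rewrite horner_coef sf2 big_ord_recl big_ord1 /= expr0 expr1 mulr1 => e.
  have f1 : f`_1 != 0 by have := lead_coefE f; rewrite sf2 /= => <-; rewrite lead_coef_eq0.
  have -> : x = - f`_0 / f`_1.
    by apply: (mulIf f1); rewrite divfK // mulrC; apply/eqP; rewrite -addr_eq0 addrC e.
  by apply: subextM => //; [apply: subextN | apply: subextV].
have yx : y != x by apply: contraNneq gx => <-.
have fy : root f y by rewrite fg rootM gy.
have ff : pmor_poly S f f by move=> i; split=> /=; first exact: Ef.
have Am := pmor_adjoin_mor Kb_alg Sm ff f0 rfx min fy.
have [s sP] := pmor_extend Kb_alg Am.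
have sE e : E e -> s e = e by move=> Ee; apply: sP; apply: (sub_pmor_adjoin Sm).
have sx : s x = y by apply: sP; apply: (mem_pmor_adjoin Sm).
case/eqP: yx; rewrite -sx; apply: fx; split=> //.
by apply: rmorph_bij => a; apply: sE; apply: subext_base.
Qed.

Section Orbits.
Variable G : set auto.
Hypothesis G_K : forall s, G s -> absgal (base_field iota) s.
Hypothesis G_comp : forall s t, G s -> G t -> G (s \o t : auto).

(** The group G may be infinite; this duplicate-free list of conjugates of a tuple is the index set
    of traces and norms. *)
Lemma finite_orbit (xs : seq Kb) : exists os : seq (seq Kb), uniq os /\
  forall ys, ys \in os <-> exists2 s, G s & ys = map s xs.
Proof.
have [os osP] : exists os : seq (seq Kb), forall s, G s -> map s xs \in os.
  elim: xs => [|x xs [os IH]]; first by exists [:: [::]].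
  have [r rP] := finite_conj x.
  exists [seq y :: ys | y <- r, ys <- os] => s Gs /=.
  by apply/allpairsP; exists (s x, map s xs); split=> //=; [apply/rP/G_K | apply: IH].
exists (undup [seq ys <- os | `[< exists2 s, G s & ys = map s xs >]]).
split; first exact: undup_uniq.
move=> ys; rewrite mem_undup mem_filter; split=> [/andP [/asboolP //]|[s Gs ->]].
by rewrite osP // andbT; apply/asboolP; exists s.
Qed.

Lemma orbit_perm (xs : seq Kb) (os : seq (seq Kb)) g : uniq os -> G g ->
  (forall ys, ys \in os <-> exists2 s, G s & ys = map s xs) ->
  perm_eq (map (map g) os) os.
Proof.
move=> uos Gg osP.
have ug : uniq (map (map g) os).
  rewrite map_inj_uniq //; apply: inj_map; exact: fmorph_inj.
have sub : {subset map (map g) os <= os}.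
  move=> _ /mapP [_ /osP [s Gs ->] ->]; apply/osP.
  by exists (g \o s : auto); [apply: G_comp | rewrite -map_comp].
have [_ /(uniq_perm ug uos) h] := uniq_min_size ug sub (eq_leq (esym (size_map _ _))).
exact: h.
Qed.

Lemma orbit_big (T : Type) (idx : T) (op : Monoid.com_law idx) (f : seq Kb -> T) xs os g :
  uniq os -> G g ->
  (forall ys, ys \in os <-> exists2 s, G s & ys = map s xs) ->
  \big[op/idx]_(ys <- os) f (map g ys) = \big[op/idx]_(ys <- os) f ys.
Proof.
move=> uos Gg osP; rewrite -[RHS](perm_big _ (orbit_perm uos Gg osP)).
by rewrite big_map.
Qed.
End Orbits.

End FixedFields.

(** * Galois invariance of the absolute value *)

Lemma archi_inv (R : realType) (e : R) : 0 < e ->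
  exists N, forall k, (N <= k)%N -> k.+1%:R^-1 < e.
Proof.
move=> e0; exists (Num.bound e^-1) => k Nk.
rewrite invf_plt ?posrE ?ltr0Sn //.
apply: lt_trans (archi_boundP _) _; first by rewrite invr_ge0 ltW.
by rewrite ltr_nat ltnS.
Qed.

(** If a > b > 0, Bernoulli's inequality makes (a / b)^n grow at least linearly in n, beyond any
    D. *)
Lemma ler_of_expr_bound (R : realType) (a b D : R) : 0 <= a -> 0 <= b ->
  (forall n, a ^+ n <= D * b ^+ n) -> a <= b.
Proof.
move=> a0 b0 h; rewrite leNgt; apply/negP => ba.
have [b_eq|bn] := eqVneq b 0.
  by have := h 1%N; rewrite b_eq !expr1 mulr0 leNgt -b_eq ba.
have b_gt : 0 < b by rewrite lt_def bn.
have [t tE t0] : exists2 t, 1 + t = a / b & 0 < t.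
  by exists (a / b - 1); rewrite ?subr_gt0 ?ltr_pdivlMr ?mul1r // addrC subrK.
have bern n : 1 + n%:R * t <= (1 + t) ^+ n.
  elim: n => [|n IH]; first by rewrite mul0r addr0 expr0.
  have t1 : 0 <= 1 + t by rewrite addr_ge0 // ltW.
  rewrite exprS; apply: le_trans (ler_wpM2l t1 IH).
  have -> : (1 + t) * (1 + n%:R * t) = 1 + n.+1%:R * t + n%:R * (t * t) by ring.
  by rewrite lerDl !mulr_ge0 // ltW.
have hD n : 1 + n%:R * t <= D.
  apply: le_trans (bern n) _.
  by rewrite tE expr_div_n ler_pdivrMr ?exprn_gt0.
have D0 : 0 <= D by have := hD 0%N; rewrite mul0r addr0; apply: le_trans.
have := hD (Num.bound (D / t)); rewrite leNgt => /negP; apply.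
apply: lt_trans (_ : D < (Num.bound (D / t))%:R * t) _; last by rewrite ltrDr.
by rewrite -ltr_pdivrMr // archi_boundP // divr_ge0 // ltW.
Qed.

Section CompleteAbsv.
Variables (R : realType) (K : fieldType) (Kb : closedFieldType).
Variables (iota : {rmorphism K -> Kb}) (v : Kb -> R).
Hypothesis va : nonarch_absv v.
Hypothesis K_complete : forall u : nat -> K,
  (forall e : R, 0 < e -> exists N, forall a b,
     (N <= a)%N -> (N <= b)%N -> v (iota (u a - u b)) < e) ->
  exists l, forall e : R, 0 < e -> exists N, forall a,
     (N <= a)%N -> v (iota (u a - l)) < e.

Let comb n (b : nat -> Kb) (c : nat -> K) := \sum_(i < n) iota (c i) * b i.

(* Norms on a finite-dimensional space over a complete field are equivalent. *)
Lemma coord_bound n (b : nat -> Kb) :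
  (forall c, comb n b c = 0 -> forall i, (i < n)%N -> c i = 0) ->
  exists2 C, 0 < C & forall c i, (i < n)%N -> v (iota (c i)) <= C * v (comb n b c).
Proof.
elim: n => [|n IH] free; first by exists 1.
have [|C C0 HC] := IH.
  move=> c c0 i i_n.
  have := free (fun i => if (i < n)%N then c i else 0) _ i (ltnW i_n); rewrite i_n.
  apply; rewrite /comb big_ord_recr /= ltnn rmorph0 mul0r addr0 -[RHS]c0.
  by apply: eq_bigr => j _; rewrite ltn_ord.
(* The vector [b n] has positive distance from the span of the preceding ones. Otherwise ever better
   approximations have Cauchy coefficients by the induction hypothesis, and their limits give a
   linear relation. *)
have [d d0 Hd] : exists2 d, 0 < d & forall c, d <= v (b n + comb n b c).
  apply: contrapT => nd.
  have /choice [c Hc] k : exists c, v (b n + comb n b c) < k.+1%:R^-1.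
    apply: contrapT => nc; apply: nd; exists k.+1%:R^-1; first by rewrite invr_gt0 ltr0Sn.
    by move=> c; rewrite leNgt; apply/negP => h; apply: nc; exists c.
  have combB x y : comb n b x - comb n b y = comb n b (fun i => x i - y i).
    by rewrite /comb -sumrB; apply: eq_bigr => i _; rewrite rmorphB mulrBl.
  have /choice [l Hl] i : exists l, (i < n)%N -> forall e : R, 0 < e -> exists N, forall a,
     (N <= a)%N -> v (iota (c a i - l)) < e.
    have [i_n|_] := boolP (i < n)%N; last by exists 0.
    have [|l Hl] := K_complete (u := fun k => c k i); last by exists l.
    move=> e e0; have [N HN] := archi_inv (divr_gt0 e0 C0); exists N => p q Np Nq.
    have := HC (fun i => c p i - c q i) i i_n; rewrite -combB => /le_lt_trans; apply.
    rewrite mulrC -ltr_pdivlMr //.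
    have -> : comb n b (c p) - comb n b (c q) =
      (b n + comb n b (c p)) - (b n + comb n b (c q)) by ring.
    by apply: absvB_lt => //; [apply: lt_trans (HN _ Np) | apply: lt_trans (HN _ Nq)].
  have lim0 : b n + comb n b l = 0.
    apply: (absv_eq0 va _).1; apply/le_anti; rewrite (absv_ge0 va) andbT.
    rewrite leNgt; apply/negP => e0.
    set e := v _ in e0; pose B := 1 + \sum_(i < n) v (b i).
    have B0 : 0 < B by rewrite ltr_pwDl // sumr_ge0 // => i _; apply: absv_ge0.
    have /choice [N HN] (i : 'I_n) : exists N, forall a, (N <= a)%N -> v (iota (c a i - l i)) < e / B.
      by apply: Hl => //; apply: divr_gt0.
    have [N0 HN0] := archi_inv e0.
    pose M := maxn N0 (\max_i N i).
    suff : e < e by rewrite ltxx.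
    have eE : b n + comb n b l = (b n + comb n b (c M)) + (comb n b l - comb n b (c M)) by ring.
    rewrite {1}/e eE; apply: absvD_lt => //.
      by apply: lt_trans (Hc _) (HN0 _ _); rewrite leq_maxl.
    rewrite combB; apply: absv_sum_lt => // i _; rewrite (absvM va).
    have vbB : v (b i) < B.
      rewrite /B (bigD1 i) //= addrCA ltrDl ltr_pwDl // sumr_ge0 // => j _; exact: absv_ge0.
    apply: le_lt_trans (_ : _ <= v (iota (l i - c M i)) * B) _.
      by rewrite ler_wpM2l ?(absv_ge0 va) // ltW.
    rewrite -ltr_pdivlMr // -opprB rmorphN absvN //; apply: HN.
    by rewrite leq_max (leq_bigmax i) orbT.
  have := free (fun i => if (i < n)%N then l i else 1) _ n (leqnn _); rewrite ltnn.
  move=> h; have /eqP : (1 : K) = 0; last by rewrite oner_eq0.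
  apply: h; rewrite /comb big_ord_recr /= ltnn rmorph1 mul1r addrC -[RHS]lim0; congr (_ + _).
  by apply: eq_bigr => i _; rewrite ltn_ord.
have Hn c : d * v (iota (c n)) <= v (comb n.+1 b c).
  have [->|cn] := eqVneq (c n) 0; first by rewrite rmorph0 absv0 // mulr0 (absv_ge0 va).
  have -> : comb n.+1 b c = iota (c n) * (b n + comb n b (fun i => c i / c n)).
    rewrite /comb big_ord_recr /= mulrDr addrC; congr (_ + _).
    rewrite mulr_sumr; apply: eq_bigr => i _.
    by rewrite mulrA -rmorphM [c n * _]mulrC divfK.
  by rewrite (absvM va) mulrC ler_wpM2l ?(absv_ge0 va).
(* The last coordinate is at most 1/d times the norm; subtracting its term multiplies the norm by at
   most 1 + v (b n) / d, to which the induction hypothesis applies. The final constant is the sum of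
   both bounds. *)
pose C' := C * (1 + v (b n) / d).
have C'0 : 0 < C' by rewrite mulr_gt0 // ltr_pwDl // divr_ge0 ?(absv_ge0 va) // ltW.
exists (C' + d^-1); first by rewrite addr_gt0 // invr_gt0.
move=> c i; rewrite ltnS leq_eqVlt => /orP [/eqP ->|i_n].
  apply: le_trans (_ : d^-1 * v (comb n.+1 b c) <= _).
    by rewrite mulrC ler_pdivlMr // mulrC.
  by rewrite ler_wpM2r ?(absv_ge0 va) // lerDr ltW.
apply: le_trans (HC _ _ i_n) _.
apply: le_trans (_ : C' * v (comb n.+1 b c) <= _); last first.
  by rewrite ler_wpM2r ?(absv_ge0 va) // lerDl invr_ge0 ltW.
rewrite /C' -mulrA ler_pM2l //.
have -> : comb n b c = comb n.+1 b c - iota (c n) * b n.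
  by rewrite /comb big_ord_recr /= addrK.
apply: absvB_le => //; rewrite mulrDl mul1r.
  by rewrite lerDl mulr_ge0 ?divr_ge0 ?(absv_ge0 va) // ltW.
apply: le_trans (_ : v (b n) / d * v (comb n.+1 b c) <= _); last by rewrite lerDr (absv_ge0 va).
rewrite (absvM va) mulrC -mulrA ler_wpM2l ?(absv_ge0 va) //.
by rewrite mulrC ler_pdivlMr // mulrC.
Qed.

Hypothesis Kb_alg : forall x, algebraicOver iota x.

(** Write x^k on the basis 1, x, ..., x^(d-1) of K(x): the coefficients have value at most C (v x)^k
    and are fixed by s. So (v (s x))^k is at most a constant times (v x)^k for all k, and the
    constant disappears on taking k-th roots. *)
Lemma absv_galois_le (s : {rmorphism Kb -> Kb}) x :
  (forall a, s (iota a) = iota a) -> v (s x) <= v x.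
Proof.
move=> sK.
pose Q n := `[< exists p : {poly K}, [/\ p != 0, root (map_poly iota p) x & size p = n] >].
have exQ : exists n, Q n.
  by have [p p0 px] := Kb_alg x; exists (size p); apply/asboolP; exists p.
case: (ex_minnP exQ) => n /asboolP [p [p0 px sp]] min.
have n0 : (0 < n)%N by rewrite -sp size_poly_gt0.
have combE y (q : {poly K}) : (size q <= n.-1)%N ->
    (map_poly iota q).[y] = comb n.-1 (fun i => y ^+ i) (fun i => q`_i).
  move=> sq; rewrite (@horner_coef_wide _ n.-1) ?size_map_poly //.
  by apply: eq_bigr => i _; rewrite coef_map.
have [c e i i_n|C C0 HC] := @coord_bound n.-1 (fun i => x ^+ i).
  pose q := \poly_(i < n.-1) c i.
  have sq : (size q <= n.-1)%N by apply: size_poly.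
  have := combE x q sq.
  have -> : comb n.-1 (fun i => x ^+ i) (fun i => q`_i) = 0.
    by rewrite -e; apply: eq_bigr => j _; rewrite coef_poly ltn_ord.
  have <- : q`_i = c i by rewrite coef_poly i_n.
  have [->|q0] := eqVneq q 0; first by rewrite coef0.
  move=> /rootP qx; have := min (size q); rewrite leqNgt (leq_ltn_trans sq) ?prednK //.
  by move=> h; have : false; last by []; apply: h; apply/asboolP; exists q.
pose B := \sum_(i < n.-1) v (s x) ^+ i.
apply: (@ler_of_expr_bound R _ _ (C * B)); rewrite ?(absv_ge0 va) // => k.
pose q := 'X^k %% p.
have sq : (size q <= n.-1)%N by rewrite -ltnS prednK // -sp ltn_modp.
have qE y : root (map_poly iota p) y -> y ^+ k = comb n.-1 (fun i => y ^+ i) (fun i => q`_i).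
  move=> py; rewrite -combE // -[LHS]hornerXn -(map_polyXn iota).
  by rewrite (divp_eq 'X^k p) rmorphD rmorphM /= hornerD hornerM (rootP py) mulr0 add0r.
rewrite -!absvX // [in X in X <= _]qE ?root_rmorph //.
apply: absv_sum_le => //.
  by rewrite !mulr_ge0 ?sumr_ge0 ?(absv_ge0 va) // ?ltW // => i _; rewrite exprn_ge0 // (absv_ge0 va).
move=> i _; rewrite (absvM va) absvX // mulrAC.
apply: ler_pM; rewrite ?exprn_ge0 ?(absv_ge0 va) //.
  by rewrite -(absvX va x) qE //; apply: HC.
by rewrite absvX // /B (bigD1 i) //= lerDl sumr_ge0 // => j _; rewrite exprn_ge0 // (absv_ge0 va).
Qed.

Lemma absv_galois s x : absgal (base_field iota) s -> v (s x) = v x.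
Proof.
move=> sG; have [t [tG st ts]] := absgal_inv sG.
apply/le_anti/andP; split.
  by apply: absv_galois_le => a; apply: sG.2; exists a.
by rewrite -{1}(st x); apply: absv_galois_le => a; apply: tG.2; exists a.
Qed.
End CompleteAbsv.

(** * Values and residues of algebraic elements *)

Section RootValues.
Variables (R : realType) (k : fieldType) (v : k -> R).
Hypothesis va : nonarch_absv v.

(* In the relation f(x) = 0 the maximal value is attained by two terms. *)
Lemma root_absv (f : {poly k}) x : f != 0 -> root f x -> x != 0 ->
  exists i j, [/\ (i < j < size f)%N, f`_i != 0, f`_j != 0 & v x ^+ (j - i) = v (f`_i / f`_j)].
Proof.
move=> f0 /rootP fx x0.
have sf : (0 < size f)%N by rewrite size_poly_gt0.
pose t (i : 'I_(size f)) := f`_i * x ^+ i.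
have vx : 0 < v x by apply: absv_gt0.
have [i imax] : exists i, forall j, v (t j) <= v (t i).
  by case: (@arg_maxP _ _ _ (Ordinal sf) xpredT (fun i => v (t i)) isT) => i _ h; exists i => j; apply: h.
have ti : t i != 0.
  have [m tm] : exists m : 'I_(size f), t m != 0.
    have lt_l : ((size f).-1 < size f)%N by rewrite prednK.
    exists (Ordinal lt_l); rewrite mulf_eq0 expf_eq0 (negPf x0) andbF orbF /=.
    by rewrite -lead_coefE lead_coef_eq0.
  have := imax m; apply: contraTneq => ->; rewrite absv0 // -ltNge; exact: absv_gt0.
have [j ji tj] : exists2 j, j != i & v (t i) <= v (t j).
  apply: contrapT => nj.
  have : v (\sum_(l | l != i) t l) < v (t i).
    apply: absv_sum_lt => //; first exact: absv_gt0.
    by move=> l li; rewrite ltNge; apply/negP => h; apply: nj; exists l.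
  move/(absvD_eq va); rewrite /t -(bigD1 i (P := predT)) //= -horner_coef fx absv0 // => /esym/eqP.
  by rewrite gt_eqF // absv_gt0.
have {imax}tij : v (t i) = v (t j) by apply/le_anti; rewrite tj imax.
have tj0 : t j != 0 by apply: contraNneq ti => tj0; apply/eqP/(absv_eq0 va); rewrite tij tj0 absv0.
have fi0 : f`_i != 0 by apply: contraNneq ti => e; rewrite /t e mul0r.
have fj0 : f`_j != 0 by apply: contraNneq tj0 => e; rewrite /t e mul0r.
have main (a b : 'I_(size f)) : (a < b)%N -> f`_b != 0 -> v (t a) = v (t b) ->
    v x ^+ (b - a) = v (f`_a / f`_b).
  move=> ab fb; rewrite /t !(absvM va) (absvV va) !(absvX va) => e.
  have vfb : v f`_b != 0 by rewrite gt_eqF ?absv_gt0.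
  apply: (mulIf (expf_neq0 a (lt0r_neq0 vx))); rewrite -exprD subnK 1?ltnW // mulrAC e.
  by rewrite mulrAC mulfV // mul1r.
move: ji; rewrite neq_lt => /orP [ji|ij]; [exists j, i|exists i, j]; split=> //.
- by rewrite -[(j < i)%N]/(j < i)%O ji ltn_ord.
- exact: main.
- by rewrite -[(i < j)%N]/(i < j)%O ij ltn_ord.
- exact: main.
Qed.

Lemma vcong_div x x' y y' : v y = 1 -> v x <= 1 ->
  vcong v x x' -> vcong v y y' -> vcong v (x / y) (x' / y').
Proof.
move=> vy vx xx yy; have vy' := vcong_eq1 va yy vy.
have n0 z : v z = 1 -> z != 0.
  by move=> vz; apply/eqP => z0; move: vz; rewrite z0 absv0 // => /eqP; rewrite eq_sym oner_eq0.
have -> : x / y = (x * y') / (y * y') by rewrite -mulf_div mulfV ?mulr1 ?n0.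
have -> : x' / y' = (x' * y) / (y * y').
  by rewrite [y * y']mulrC -mulf_div mulfV ?mulr1 ?n0.
rewrite /vcong -mulrBl (absvM va) (absvV va) (absvM va) vy vy' mulr1 invr1 mulr1.
by apply: vcongM; rewrite ?vy //; apply: vcong_sym.
Qed.

Section RatValues.
Variables (h : {rmorphism rat -> k}) (p : nat).
Hypotheses (p_prime : prime p) (vp : v p%:R < 1).

Lemma rat_morphE q : h q = (numq q)%:~R / (denq q)%:~R.
Proof. by rewrite -{1}(divq_num_den q) fmorph_div !rmorph_int. Qed.

Lemma absv_int (z : int) : v z%:~R = v `|z|%N%:R.
Proof. by case: z => n; rewrite ?NegzE ?mulrNz ?absvN // abszN. Qed.

Lemma charf0_absv n : (n%:R == 0 :> k) = (n == 0%N).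
Proof. by rewrite -(rmorph_nat h) fmorph_eq0 pnatr_eq0. Qed.

Lemma absvp_gt0 : 0 < v p%:R.
Proof. by apply: absv_gt0; rewrite // charf0_absv gtn_eqF // prime_gt0. Qed.

Lemma absv_natE n : (0 < n)%N -> v n%:R = v p%:R ^+ logn p n.
Proof.
move=> n0; rewrite {1}(esym (partnC p n0)) natrM (absvM va) p_part natrX (absvX va).
by rewrite [v (n`_ _)%:R](absv_ndvdn va p_prime vp) ?mulr1 // -p'natE // part_pnat.
Qed.

Lemma absv_rat q : h q != 0 -> exists i j, v (h q) = v p%:R ^+ i / v p%:R ^+ j.
Proof.
move=> q0; exists (logn p `|numq q|), (logn p `|denq q|).
rewrite rat_morphE (absvM va) (absvV va) (absv_int (numq q)) (absv_int (denq q)).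
rewrite (@absv_natE `|numq q|) ?(@absv_natE `|denq q|) ?absz_gt0 ?denq_neq0 //.
by apply: contraNneq q0 => q0; rewrite rat_morphE q0 mul0r.
Qed.

Lemma vcong_int_fermat (z : int) : vcong v (z%:~R ^+ p) z%:~R.
Proof.
case: z => n; first exact: vcong_nat_fermat.
rewrite NegzE mulrNz -[p in _ ^+ p]expn1.
apply: vcong_trans (vcong_frobXN va p_prime vp 1 (absv_nat va _)) _ => //.
by rewrite expn1; apply: vcongN => //; apply: vcong_nat_fermat.
Qed.

(** In lowest terms the denominator is prime to p, since otherwise the value would exceed 1;
    Fermat's little theorem then passes to the quotient. *)
Lemma vcong_rat_fermat q : v (h q) <= 1 -> vcong v (h q ^+ p) (h q).
Proof.
move=> q1; rewrite rat_morphE expr_div_n.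
have vn (z : int) : v z%:~R <= 1 by rewrite absv_int absv_nat.
suff vd : v (denq q)%:~R = 1.
  apply: vcong_div; rewrite ?(absvX va) ?vd ?expr1n ?exprn_ile1 ?(absv_ge0 va) //;
    exact: vcong_int_fermat.
apply/le_anti; rewrite vn /= leNgt; apply/negP => vd.
have pd : (p %| `|denq q|)%N.
  by apply: contraLR vd => /(absv_ndvdn va p_prime vp); rewrite -(absv_int (denq q)) => ->; rewrite ltxx.
have pn : ~~ (p %| `|numq q|)%N.
  apply/negP => pn; have : (p %| gcdn `|numq q| `|denq q|)%N by rewrite dvdn_gcd pn.
  by rewrite (eqP (coprime_num_den q)) Euclid_dvd1.
move: q1; rewrite rat_morphE (absvM va) (absvV va) [v (numq q)%:~R]absv_int.
rewrite (absv_ndvdn va p_prime vp pn) mul1r invf_ple ?posrE ?invr1 //.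
  by rewrite leNgt vd.
by apply: absv_gt0; rewrite // -(rmorph_int h) fmorph_eq0 intr_eq0 denq_neq0.
Qed.

(* v x ^+ e is a power of v p for some positive e <= D. *)
Lemma absv_rat_root (f : {poly rat}) D x : f != 0 -> (size f <= D.+1)%N ->
  root (map_poly h f) x -> v x < 1 -> v x ^+ D <= v p%:R.
Proof.
move=> f0 sf fx x1; have [->|x0] := eqVneq x 0.
  case: D sf => [|D] sf; last by rewrite (absv0 va) expr0n (absv_ge0 va).
  have : (1 < size f)%N by rewrite -(size_map_poly h) (root_size_gt1 _ fx) // map_poly_eq0.
  by rewrite ltnNge sf.
have hf0 : map_poly h f != 0 by rewrite map_poly_eq0.
have [i [j [/andP [ij]]]] := root_absv hf0 fx x0.
rewrite size_map_poly !coef_map -fmorphV -rmorphM => jf fi0 fj0 e.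
have [|a [b ab]] := @absv_rat (f`_i / f`_j).
  by rewrite rmorphM fmorphV mulf_neq0 // invr_eq0.
have vp0 := absvp_gt0.
have ji0 : (0 < j - i)%N by rewrite subn_gt0.
have : v x ^+ (j - i) < 1 by rewrite expr_lt1 // (absv_ge0 va).
rewrite e ab ltr_pdivrMr ?exprn_gt0 // mul1r => lab.
have ba : (b < a)%N.
  rewrite ltnNge; apply/negP => ab'; move: lab; rewrite ltNge => /negP; apply.
  by rewrite ler_wiXn2l ?(absv_nat va) // ltW.
apply: (@le_trans _ _ (v x ^+ (j - i))).
  apply: ler_wiXn2l; rewrite ?(absv_ge0 va) ?(ltW x1) // leq_subLR.
  by apply: leq_trans (leq_addl _ _); rewrite -ltnS; apply: leq_trans jf sf.
rewrite e ab ler_pdivrMr ?exprn_gt0 // -exprS.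
by rewrite ler_wiXn2l ?(absv_nat va) // ltW.
Qed.

(** An absolute value that is trivial on the positive integers is trivial on algebraic numbers. This
    forces a finite prime to be nontrivial on Q. *)
Lemma absv_rat_root_unit (f : {poly rat}) x : f != 0 -> root (map_poly h f) x -> x != 0 ->
  (forall n, (0 < n)%N -> v n%:R = 1) -> v x = 1.
Proof.
move=> f0 fx x0 triv.
have hf0 : map_poly h f != 0 by rewrite map_poly_eq0.
have [i [j [/andP [ij _]]]] := root_absv hf0 fx x0; rewrite !coef_map => fi0 fj0 e.
have vq q : h q != 0 -> v (h q) = 1.
  move=> q0; rewrite rat_morphE (absvM va) (absvV va) (absv_int (numq q)) (absv_int (denq q)) !triv ?divr1 ?absz_gt0 ?denq_neq0 //.
  by apply: contraNneq q0 => q0; rewrite rat_morphE q0 mul0r.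
move: e; rewrite (absvM va) (absvV va) !vq // divr1 => /eqP.
by rewrite pexpr_eq1 ?subn_gt0 ?(absv_ge0 va) // => /eqP.
Qed.
End RatValues.
End RootValues.

(** * Residue classes algebraic over the prime field *)

Section ResidueField.
Variables (R : realType) (Kb : closedFieldType) (v : Kb -> R) (p : nat).
Hypotheses (va : nonarch_absv v) (p_prime : prime p) (vp : v p%:R < 1).

(* The residue class of x is algebraic over the prime field. *)
Definition resalg x := exists2 r, (0 < r)%N & vcong v (x ^+ (p ^ r)) x.

Lemma vcong_frob_iter r i x : v x <= 1 ->
  vcong v (x ^+ (p ^ r)) x -> vcong v (x ^+ (p ^ (r * i))) x.
Proof.
move=> x1 xr; elim: i => [|i IH]; first by rewrite muln0 expr1 vcong_refl.
rewrite mulnS expnD exprM; apply: vcong_trans IH => //.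
by apply: vcongX => //; rewrite absvX_le1.
Qed.

Lemma resalg_cong x y : v x <= 1 -> vcong v x y -> resalg x -> resalg y.
Proof.
move=> x1 xy [r r0 xr]; exists r => //.
apply: (vcong_trans va _ xy); apply: (vcong_trans va _ xr).
by apply: vcongX; rewrite ?(vcong_le1 va xy) //; apply: vcong_sym.
Qed.

Lemma resalg_common n (c : nat -> Kb) : (forall i, v (c i) <= 1) ->
  (forall i, (i < n)%N -> resalg (c i)) ->
  exists2 r, (0 < r)%N & forall i, (i < n)%N -> vcong v (c i ^+ (p ^ r)) (c i).
Proof.
move=> c1; elim: n => [|n IH] cT; first by exists 1%N.
have [|r r0 Hr] := IH; first by move=> i i_n; apply/cT/ltnW.
have [r' r'0 Hr'] := cT n (leqnn _).
exists (r * r')%N; first by rewrite muln_gt0 r0.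
move=> i; rewrite ltnS leq_eqVlt => /orP [/eqP ->|i_n].
  by rewrite mulnC; apply: vcong_frob_iter.
by apply: vcong_frob_iter => //; apply: Hr.
Qed.

(* If f is stable under the q-power map modulo the maximal ideal, then all x^(q^k) are
   congruent to roots of f, so two of them are congruent. *)
Lemma resalg_monic_root (f : {poly Kb}) x : f \is monic ->
  (forall i, v f`_i <= 1) -> (forall i, (i < size f)%N -> resalg f`_i) ->
  v x <= 1 -> v f.[x] < 1 -> resalg x.
Proof.
move=> fm f1 fT x1 fx.
have [r r0 Hr] := resalg_common f1 fT; set q := (p ^ r)%N in Hr.
have step y : v y <= 1 -> v f.[y] < 1 -> v f.[y ^+ q] < 1.
  move=> y1 fy; apply: (@vcong_lt1 _ _ _ va (f.[y] ^+ q)); last first.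
    by rewrite absvX_lt1 // expn_gt0 prime_gt0.
  rewrite !horner_coef; apply: (vcong_trans va (vcong_frob_sum va p_prime vp _ _ _)).
    by move=> i _; rewrite absvM_le1 ?absvX_le1.
  apply: vcong_sum => // i _; rewrite exprMn -!exprM mulnC.
  by apply: vcongM; rewrite ?absvX_le1 ?vcong_refl //; apply: Hr.
have fxk k : v f.[x ^+ (q ^ k)] < 1.
  elim: k => [|k IH]; first by rewrite expn0 expr1.
  by rewrite expnSr exprM; apply: step => //; rewrite absvX_le1.
have [ys fE] := closed_field_poly_normal f; rewrite (monicP fm) scale1r in fE.
have near_root k : exists i : 'I_(size ys), vcong v (x ^+ (q ^ k)) ys`_i.
  have := fxk k; rewrite fE horner_prod; under eq_bigr do rewrite hornerXsubC.
  case/(absv_prod_lt1 va) => y y_ys xy; have i_lt := y_ys; rewrite -index_mem in i_lt.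
  by exists (Ordinal i_lt); rewrite /= nth_index.
have [c Hc] := choice near_root.
have [k [l [kl ckl]]] : exists k l, (k < l)%N /\ c k = c l.
  have : ~~ injectiveb (fun k : 'I_(size ys).+1 => c k).
    apply/injectiveP => cinj; have := leq_card _ cinj.
    by rewrite !card_ord ltnn.
  case/injectivePn => k [l kl ckl]; have := kl; rewrite neq_lt => /orP [] h.
    by exists k, l.
  by exists l, k.
exists (r * (l - k))%N; first by rewrite muln_gt0 r0 subn_gt0.
rewrite expnM -/q; apply/vcong_sym/(@vcong_frob_inj _ _ _ va _ p_prime vp (r * k)) => //.
  by rewrite absvX_le1.
rewrite expnM -/q -exprM -expnD subnK ?(ltnW kl) //.
by apply: (vcong_trans va (Hc k)); rewrite ckl; apply: vcong_sym.
Qed.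

(** Let d be the last index at which v f_i is maximal. After division by f_d the terms above d
    become small, so the part of degree at most d is monic, integral and small at x. *)
Lemma resalg_root (f : {poly Kb}) x : f != 0 -> root f x -> v x <= 1 ->
  (forall i j, f`_j != 0 -> v (f`_i / f`_j) <= 1 -> resalg (f`_i / f`_j)) -> resalg x.
Proof.
move=> f0 /rootP fx x1 fT.
have sf : (0 < size f)%N by rewrite size_poly_gt0.
pose Q d := (d < size f)%N && `[< forall j, v f`_j <= v f`_d >].
have exQ : exists d, Q d.
  case: (@arg_maxP _ _ _ (Ordinal sf) xpredT (fun i => v f`_i) isT) => i _ h.
  exists i; rewrite /Q ltn_ord; apply/asboolP => j.
  have [j_f|f_j] := ltnP j (size f); first exact: (h (Ordinal j_f)).
  by rewrite nth_default // absv0 // (absv_ge0 va).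
have [d /andP [df /asboolP dmax] dlast] := ex_maxnP exQ (fun d Qd => ltnW (proj1 (andP Qd))).
have fd0 : f`_d != 0.
  apply: contraNneq f0 => fd; rewrite -lead_coef_eq0; apply/eqP/(absv_eq0 va)/le_anti.
  by rewrite (absv_ge0 va) andbT lead_coefE (le_trans (dmax _)) // fd absv0.
have vfd : 0 < v f`_d by apply: absv_gt0.
pose g := \poly_(i < d.+1) (f`_i / f`_d).
have g1 i : v (f`_i / f`_d) <= 1 by rewrite (absvM va) (absvV va) ler_pdivrMr // mul1r.
have gl : v (lead_coef g) = 1.
  rewrite lead_coef_poly //; first by rewrite mulfV // absv1.
  by rewrite mulfV // oner_neq0.
apply: (@resalg_monic_root g); rewrite ?x1 //.
- by rewrite monicE lead_coef_poly ?mulfV // oner_neq0.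
- by move=> i; rewrite coef_poly; case: ifP => _ //; rewrite absv0.
- move=> i _; rewrite coef_poly; case: ifP => _; first exact: fT.
  by exists 1%N; rewrite // expr0n expn1 gtn_eqF ?prime_gt0 // vcong_refl.
have -> : g.[x] = (f`_d)^-1 * (\sum_(0 <= i < d.+1) f`_i * x ^+ i).
  rewrite horner_poly mulr_sumr big_mkord; apply: eq_bigr => i _.
  by rewrite mulrA [_^-1 * _]mulrC.
have : \sum_(0 <= i < size f) f`_i * x ^+ i = 0 by rewrite big_mkord -horner_coef.
rewrite (big_cat_nat (n := d.+1)) //= => /eqP; rewrite addr_eq0 => /eqP ->.
rewrite mulrN absvN // (absvM va) (absvV va) mulrC ltr_pdivrMr // mul1r.
rewrite big_seq; apply: absv_sum_lt => // i; rewrite mem_index_iota => /andP [di i_f].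
rewrite (absvM va) (absvX va); apply: le_lt_trans (_ : v f`_i < _).
  by rewrite ler_piMr ?(absv_ge0 va) // exprn_ile1 // (absv_ge0 va).
rewrite ltNge; apply/negP => fdi; suff : (i <= d)%N by rewrite leqNgt di.
by apply: dlast; rewrite /Q i_f; apply/asboolP => j; apply: le_trans fdi.
Qed.

Lemma root_of_expr_eq (n : nat) : (1 < n)%N -> exists2 zs : seq Kb,
  'X^n - 'X = \prod_(z <- zs) ('X - z%:P) & forall z, z \in zs -> z ^+ n = z.
Proof.
move=> n1; have [zs] := closed_field_poly_normal ('X^n - 'X : {poly Kb}).
have sX : (size (- 'X : {poly Kb}) < size ('X^n : {poly Kb}))%N.
  by rewrite size_polyN size_polyX size_polyXn ltnS.
rewrite lead_coefDl // lead_coefXn scale1r => e; exists zs => // z.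
by rewrite -root_prod_XsubC -e rootE !hornerE subr_eq0 => /eqP.
Qed.

(** The polynomial X^(p^r) - X splits in Kb and is small at x, so one of its roots is congruent to
    x. *)
Lemma teich_exists x : v x <= 1 -> resalg x ->
  exists r z, [/\ (0 < r)%N, z ^+ (p ^ r) = z & vcong v x z].
Proof.
move=> x1 [r r0 xr].
have q1 : (1 < p ^ r)%N by rewrite -(exp1n r) ltn_exp2r // prime_gt1.
have [zs e zsP] := root_of_expr_eq q1.
have : v ('X^(p ^ r) - 'X).[x] < 1 by rewrite !hornerE.
rewrite e horner_prod; under eq_bigr do rewrite hornerXsubC.
by case/(absv_prod_lt1 va) => z /zsP zr xz; exists r, z.
Qed.

(* The p integers 0, ..., p - 1 lift to all p solutions of z ^ p = z. *)
Lemma vcong_prime_field c : v c <= 1 -> vcong v (c ^+ p) c -> exists n : nat, vcong v c n%:R.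
Proof.
move=> c1 cp.
have lift x : v x <= 1 -> vcong v (x ^+ p) x -> exists z, z ^+ p = z /\ vcong v x z.
  move=> x1 xp; have [zs e zsP] := root_of_expr_eq (prime_gt1 p_prime).
  have : v ('X^p - 'X).[x] < 1 by rewrite !hornerE.
  rewrite e horner_prod; under eq_bigr do rewrite hornerXsubC.
  by case/(absv_prod_lt1 va) => z /zsP zr xz; exists z.
have /choice [t Ht] (n : nat) : exists z, z ^+ p = z /\ vcong v n%:R z.
  by apply: lift; [apply: absv_nat | apply: vcong_nat_fermat].
have [z [zp cz]] := lift c c1 cp.
have inj z1 z2 : z1 ^+ p = z1 -> z2 ^+ p = z2 -> vcong v z1 z2 -> z1 = z2.
  by move=> h1 h2; apply: (@teich_inj _ _ _ va _ p_prime vp 1); rewrite ?expn1.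
have [/mapP [n _ zn]|z_ts] := boolP (z \in [seq t i | i <- iota 0 p]).
  by exists n; apply: (vcong_trans va cz); rewrite zn; apply: vcong_sym; case: (Ht n).
have uts : uniq (z :: [seq t i | i <- iota 0 p]).
  rewrite /= z_ts map_inj_in_uniq ?iota_uniq // => i j.
  rewrite !mem_iota /= add0n => ip jp tij.
  wlog ij : i j ip jp tij / (i <= j)%N.
    by move=> h; have [/h->|/ltnW/h->] := leqP i j.
  apply/eqP; rewrite eqn_leq ij /= leqNgt; apply/negP => ltij.
  have : vcong v i%:R j%:R.
    apply: (vcong_trans va (proj2 (Ht i))); rewrite tij; apply: vcong_sym; by case: (Ht j).
  move/(vcong_sym va); rewrite /vcong -natrB // => /lt_eqF.
  rewrite (absv_ndvdn va p_prime vp) ?eqxx //; apply/negP => /dvdn_leq.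
  by rewrite subn_gt0 ltij => /(_ isT); rewrite leqNgt (leq_ltn_trans (leq_subr _ _)).
have sX : size ('X^p - 'X : {poly Kb}) = p.+1.
  by rewrite size_polyDl size_polyXn // size_polyN size_polyX ltnS prime_gt1.
suff : (size (z :: [seq t i | i <- iota 0 p]) < p.+1)%N by rewrite /= size_map size_iota ltnn.
rewrite -sX; apply: max_poly_roots => //; first by rewrite -size_poly_eq0 sX.
apply/allP => y; rewrite inE rootE !hornerE subr_eq0 => /orP [/eqP ->|/mapP [i _ ->]].
  by rewrite zp.
by case: (Ht i) => ->.
Qed.
End ResidueField.

(** The bound on the degree is uniform in x, and discreteness of the values rests on this. *)
Lemma numfield_root (F : fieldExtType rat) (x : F) : exists f : {poly rat},
  [/\ f != 0, (size f <= (\dim {:F}).+1)%N & root (map_poly (in_alg F) f) x].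
Proof.
have /polyOver1P [f fE] := minPolyOver 1%AS x; exists f.
have f0 : map_poly (in_alg F) f != 0 by rewrite -fE monic_neq0 ?monic_minPoly.
split; first by rewrite map_poly_eq0 in f0.
  rewrite -(size_map_poly (in_alg F)) -fE size_minPoly ltnS.
  by have := dim_Fadjoin 1%AS x; rewrite dimv1 muln1 => <-; rewrite dimvS // subvf.
by rewrite -fE root_minPoly.
Qed.

(** * The completion of a number field: residue characteristic, discreteness, residues *)

Section LocalField.
Variables (R : realType) (F : fieldExtType rat) (vF : F -> R).
Variables (K : fieldType) (vK : K -> R) (j : {rmorphism F -> K}).
Variables (Kb : closedFieldType) (iota : {rmorphism K -> Kb}) (v : Kb -> R).
Hypotheses (vF_prime : finite_prime vF) (K_completion : is_completion vF vK j).
Hypotheses (Kb_alg : forall x, algebraicOver iota x) (va : nonarch_absv v).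
Hypothesis v_ext : forall x, v (iota x) = vK x.

Let h : {rmorphism F -> Kb} := iota \o j.
Let hQ : {rmorphism rat -> Kb} := h \o in_alg F.

Lemma absv_numfield x : v (h x) = vF x.
Proof. by rewrite /h /= v_ext (compl_ext K_completion). Qed.

Lemma local_char0 : [pchar K] =i pred0.
Proof. by move=> q; rewrite (fmorph_pchar (j \o in_alg F)) pchar_num. Qed.

Lemma numfield_root_Kb (x : F) : exists f : {poly rat},
  [/\ f != 0, (size f <= (\dim {:F}).+1)%N & root (map_poly hQ f) (h x)].
Proof.
have [f [f0 sf fx]] := numfield_root x; exists f; split=> //.
have -> : map_poly hQ f = map_poly h (map_poly (in_alg F) f) by rewrite -map_poly_comp.
by rewrite fmorph_root.
Qed.

(** Since v is nontrivial on F, some positive integer has value below 1, and so has one of its prime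
    factors. *)
Lemma residue_char : exists2 p, prime p & v p%:R < 1.
Proof.
have [_ [x x0 vx]] := vF_prime.
have [triv|/existsNP [n]] := EM (forall n, (0 < n)%N -> v n%:R = 1).
  have [f [f0 _ fx]] := numfield_root_Kb x; case: vx; rewrite -absv_numfield.
  by apply: (absv_rat_root_unit va f0 fx) => //; rewrite fmorph_eq0.
rewrite not_implyE => -[n0 vn].
have {}vn : v n%:R < 1 by rewrite lt_neqAle absv_nat // andbT; apply/eqP.
apply: contrapT => np; move: vn; rewrite ltNge => /negP; apply.
rewrite [n]prod_prime_decomp // natr_prod absv_prod //.
rewrite big_seq (_ : \prod_(i <- _ | _) _ = \prod_(i <- prime_decomp n | i \in prime_decomp n) 1).
  by rewrite big1.
apply: eq_bigr => -[q e] /mem_prime_decomp [q_prime _ _] /=.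
rewrite natrX absvX //; suff -> : v q%:R = 1 by rewrite expr1n.
by apply/le_anti; rewrite absv_nat // leNgt; apply/negP => vq; apply: np; exists q.
Qed.

Section ResidueChar.
Variable p : nat.
Hypotheses (p_prime : prime p) (vp : v p%:R < 1).

Lemma dense_numfield y : y != 0 -> exists x, v (h x - iota y) < v (iota y).
Proof.
move=> y0; have [|x xy] := compl_dense K_completion y (e := v (iota y)).
  by apply: absv_gt0; rewrite // fmorph_eq0.
by exists x; rewrite absv_dist // /h /= -rmorphB [X in X < _]v_ext.
Qed.

(** By density a nonzero y has the same value as some x of F, whose degree over Q is at most
    [F:Q]. *)
Lemma local_discrete y : v (iota y) < 1 -> v (iota y) ^+ \dim {:F} <= v p%:R.
Proof.
have [->|y0 y1] := eqVneq y 0.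
  rewrite rmorph0 absv0 // expr0n gtn_eqF ?adim_gt0 // => _.
  exact: absv_ge0.
have [x xy] := dense_numfield y0.
have e : v (h x) = v (iota y) by rewrite -(absvD_eq va xy) addrC subrK.
have [f [f0 sf fx]] := numfield_root_Kb x.
by rewrite -e; apply: (absv_rat_root va p_prime vp f0 sf fx); rewrite e.
Qed.

(** Rational coefficients satisfy Fermat's congruence, which settles the case of F. Density
    transfers it to K, and a polynomial over K annihilating x transfers it to Kb. *)
Lemma local_resalg x : v x <= 1 -> resalg v p x.
Proof.
move=> x1.
have resalg_F y : v (h y) <= 1 -> resalg v p (h y).
  move=> y1; have [f [f0 _ fy]] := numfield_root_Kb y.
  apply: (resalg_root va p_prime vp _ fy) => //; first by rewrite map_poly_eq0.
  move=> i l; rewrite !coef_map => _; rewrite -fmorphV -rmorphM => h1.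
  by exists 1%N => //; rewrite expn1; apply: vcong_rat_fermat.
have resalg_K y : v (iota y) <= 1 -> resalg v p (iota y).
  have [->|y0 y1] := eqVneq y 0.
    by rewrite rmorph0 -(rmorph0 h) => h0; apply: resalg_F.
  have [z zy] := dense_numfield y0.
  have zy1 : vcong v (h z) (iota y) by apply: lt_le_trans zy y1.
  have z1 : v (h z) <= 1 by apply: (vcong_le1 va _ y1); apply: vcong_sym.
  by apply: (resalg_cong va z1 zy1); apply: resalg_F.
have [f f0 fx] := Kb_alg x.
apply: (resalg_root va p_prime vp _ fx) => //; first by rewrite map_poly_eq0.
by move=> i l; rewrite !coef_map => _; rewrite -fmorphV -rmorphM; apply: resalg_K.
Qed.
End ResidueChar.

Lemma local_complete (u : nat -> K) :
  (forall e : R, 0 < e -> exists N, forall a b,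
     (N <= a)%N -> (N <= b)%N -> v (iota (u a - u b)) < e) ->
  exists l, forall e : R, 0 < e -> exists N, forall a,
     (N <= a)%N -> v (iota (u a - l)) < e.
Proof.
move=> uc; have [e e0|l Hl] := compl_complete K_completion (u := u).
  by have [N HN] := uc e e0; exists N => a b Na Nb; rewrite -v_ext HN.
by exists l => e e0; have [N HN] := Hl e e0; exists N => a Na; rewrite v_ext HN.
Qed.

Lemma local_galois s x : absgal (base_field iota) s -> v (s x) = v x.
Proof. exact: (absv_galois va local_complete Kb_alg). Qed.
End LocalField.

(** * Unramified extensions *)

Section Unramified.
Variables (R : realType) (K : fieldType) (Kb : closedFieldType).
Variables (iota : {rmorphism K -> Kb}) (v : Kb -> R) (p : nat).
Hypothesis Kb_alg : forall x, algebraicOver iota x.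
Hypothesis K_char0 : [pchar K] =i pred0.
Hypotheses (va : nonarch_absv v) (p_prime : prime p) (vp : v p%:R < 1).
Hypothesis v_gal : forall s x, absgal (base_field iota) s -> v (s x) = v x.
Hypothesis res_alg : forall x, v x <= 1 -> resalg v p x.
Local Notation auto := {rmorphism Kb -> Kb}.
Implicit Types (E N : set Kb) (s t : auto).

Lemma absgal_base E s : subext iota E -> absgal E s -> absgal (base_field iota) s.
Proof. by move=> Es; apply: absgal_sub; apply: base_sub_subext. Qed.

Definition fixes_mu r s := forall z, z ^+ (p ^ r) = z -> s z = z.

(** For a subextension E and r > 0 this is the field E(zeta), with zeta a primitive root of unity of
    order p^r - 1, described by Galois theory instead of by polynomials in zeta. *)
Definition unr_level E r : set Kb :=
  [set x | forall s, absgal E s -> fixes_mu r s -> s x = x].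

(* E(mu'), where mu' is the group of roots of unity of order prime to p *)
Definition unr_closure E : set Kb := [set x | exists2 r, (0 < r)%N & unr_level E r x].

Lemma mu_gen r : (0 < r)%N -> exists zeta : Kb, zeta ^+ (p ^ r) = zeta /\
  forall z, z ^+ (p ^ r) = z -> z = 0 \/ exists i, z = zeta ^+ i.
Proof.
move=> r0; pose n := (p ^ r).-1.
have q1 : (1 < p ^ r)%N by rewrite -(exp1n r) ltn_exp2r // prime_gt1.
have nE : (p ^ r = n.+1)%N by rewrite prednK // ltnW.
have n0 : (0 < n)%N by rewrite -ltnS -nE.
have [rs] := closed_field_poly_normal ('X^n - 1 : {poly Kb}).
rewrite lead_coefXnsubC // scale1r => Dp.
have rn1 : all n.-unity_root rs by apply/allP => z; rewrite -root_prod_XsubC -Dp.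
have sz : (n <= size rs)%N by rewrite -ltnS -(size_prod_XsubC rs id) -Dp size_XnsubC.
have urs : uniq rs.
  rewrite -separable_prod_XsubC -Dp cyclotomic.separable_Xn_sub_1 //.
  by rewrite ((pcharf0P _).1 (Kb_char0 iota K_char0)) -lt0n.
have [z zrs zprim] := hasP (has_prim_root n0 rn1 urs sz); exists z.
split; first by rewrite nE exprS prim_expr_order ?mulr1.
move=> y; rewrite nE exprS; have [->|y0] := eqVneq y 0; first by left.
rewrite -[RHS]mulr1 => /(mulfI y0) /(prim_rootP zprim) [i ->].
by right; exists i.
Qed.

Lemma fixes_mu_gen r (zeta : Kb) s : (0 < r)%N ->
  (forall z, z ^+ (p ^ r) = z -> z = 0 \/ exists i, z = zeta ^+ i) ->
  s zeta = zeta -> fixes_mu r s.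
Proof.
move=> r0 gen sz z /gen [->|[i ->]]; first exact: rmorph0.
by rewrite rmorphXn sz.
Qed.

Lemma fixes_mu_dvd r i s : fixes_mu (r * i) s -> fixes_mu r s.
Proof. by move=> fs z zr; apply/fs/expr_frob_iter. Qed.

Lemma mu_rmorph r s (z : Kb) : z ^+ (p ^ r) = z -> s z ^+ (p ^ r) = s z.
Proof. by move=> zr; rewrite -rmorphXn zr. Qed.

Lemma unr_level_agree E r s t x : absgal E s -> absgal E t ->
  (forall z, z ^+ (p ^ r) = z -> s z = t z) -> unr_level E r x -> s x = t x.
Proof.
move=> sE tE st xE; have [t' [t'E tK t'K]] := absgal_inv tE.
have := xE (t' \o s : auto) (absgal_comp t'E sE); move=> /= h.
by rewrite -[LHS]t'K h // => z zr /=; rewrite st // tK.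
Qed.

Lemma prod_XsubC_le1 (as_ : seq Kb) : {in as_, forall a, v a <= 1} ->
  forall k, v (\prod_(a <- as_) ('X - a%:P))`_k <= 1.
Proof.
elim: as_ => [|a l IH] l1 k.
  by rewrite big_nil coefC; case: eqP => _; rewrite ?absv0 ?absv1.
have {}IH : forall k, v (\prod_(a <- l) ('X - a%:P))`_k <= 1.
  by apply: IH => b bl; apply: l1; rewrite inE bl orbT.
rewrite big_cons mulrBl coefB coefXM coefCM absvB_le //.
  by case: ifP; rewrite ?absv0.
by rewrite absvM_le1 // l1 ?mem_head.
Qed.

(** Modulo the maximal ideal the p-th power map is a ring morphism, so applying it to the
    coefficients of a split polynomial applies it to the roots. *)
Lemma prod_XsubC_frob (as_ : seq Kb) : {in as_, forall a, v a <= 1} -> forall k,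
  vcong v ((\prod_(a <- as_) ('X - a%:P))`_k ^+ p) (\prod_(a <- as_) ('X - (a ^+ p)%:P))`_k.
Proof.
elim: as_ => [|a l IH] l1 k.
  rewrite !big_nil !coefC; case: eqP => _; rewrite ?expr1n ?expr0n ?gtn_eqF ?prime_gt0 //;
    exact: (vcong_refl va).
have l1' : {in l, forall a, v a <= 1} by move=> b bl; apply: l1; rewrite inE bl orbT.
have a1 : v a <= 1 by rewrite l1 ?mem_head.
have {}IH := IH l1'; have P1 := prod_XsubC_le1 l1'.
rewrite !big_cons !mulrBl !coefB !coefXM !coefCM.
set P := (\prod_(j <- l) ('X - j%:P)) in IH P1 *.
apply: (@vcong_trans _ _ _ va ((if k == 0%N then 0 else P`_k.-1) ^+ p - (a * P`_k) ^+ p)).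
  have := @vcong_frobXB _ _ _ va _ p_prime vp 1; rewrite !expn1; apply.
    by case: ifP; rewrite ?absv0.
  by rewrite absvM_le1.
apply: vcongB => //.
  case: ifP => // _; rewrite expr0n gtn_eqF ?prime_gt0 //; exact: (vcong_refl va).
rewrite exprMn; apply: vcongM; rewrite ?absvX_le1 //; last exact: (vcong_refl va).
by apply: (vcong_le1 va (IH k)); rewrite absvX_le1.
Qed.

(* h := \prod_(j < r) (X - zeta^(p^j)) is congruent to a polynomial with integer
   coefficients, hence to its conjugate by s, which vanishes at s zeta. *)
Lemma absgal_mu s r : absgal (base_field iota) s -> (0 < r)%N ->
  exists i, forall z, z ^+ (p ^ r) = z -> s z = z ^+ (p ^ i).
Proof.
move=> sG r0; have [zeta [zr gen]] := mu_gen r0.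
suff [i szeta] : exists i, s zeta = zeta ^+ (p ^ i).
  exists i => z /gen [->|[l ->]]; last by rewrite rmorphXn szeta exprAC.
  by rewrite rmorph0 expr0n expn_eq0 (gtn_eqF (prime_gt0 p_prime)).
have z1 := teich_le1 va p_prime r0 zr.
pose cs := [seq zeta ^+ (p ^ i) | i <- index_iota 0 r]; pose h := \prod_(a <- cs) ('X - a%:P).
have cs1 : {in cs, forall a, v a <= 1} by move=> _ /mapP [i _ ->]; rewrite absvX_le1.
(* The p-th power map permutes the zeta^(p^i), i < r, cyclically because zeta^(p^r) = zeta. So each
   coefficient of h is congruent to its p-th power, hence to an integer. *)
have hE : \prod_(a <- cs) ('X - (a ^+ p)%:P) = h.
  rewrite /h !big_map -(prednK r0) big_nat_recr // [RHS]big_nat_recl //= expn0 expr1.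
  rewrite mulrC -exprM -expnSr prednK // zr; congr (_ * _).
  by apply: eq_bigr => i _; rewrite -exprM -expnSr.
have h1 := prod_XsubC_le1 cs1.
have hz : h.[zeta] = 0.
  rewrite horner_prod big_map -(prednK r0) big_nat_recl //= hornerXsubC.
  by rewrite expn0 expr1 subrr mul0r.
have sh k : vcong v h`_k (s h`_k).
  have [n hn] : exists n : nat, vcong v h`_k n%:R.
    apply: (vcong_prime_field va p_prime vp (h1 k)).
    by have := prod_XsubC_frob cs1 k; rewrite hE.
  apply: (vcong_trans va hn); apply: vcong_sym => //.
  by rewrite /vcong -(rmorph_nat s) -rmorphB v_gal.
have : v h.[s zeta] < 1.
  apply: (@vcong_lt1 _ _ _ va (map_poly s h).[s zeta]); last by rewrite horner_map hz rmorph0 absv0.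
  rewrite !(@horner_coef_wide _ (size h)) ?size_map_poly //; apply: vcong_sym => //.
  apply: vcong_sum => // k _; rewrite coef_map; apply: vcongM => //; last exact: (vcong_refl va).
  by rewrite absvX_le1 // v_gal.
rewrite horner_prod; under eq_bigr do rewrite hornerXsubC.
case/(absv_prod_lt1 va) => _ /mapP [i _ ->] szi; exists i.
apply: (@teich_inj _ _ _ va _ p_prime vp r) => //; first exact: mu_rmorph.
by rewrite exprAC zr.
Qed.

Section Closure.
Variable E : set Kb.
Hypothesis Es : subext iota E.

Lemma sub_unr_closure : E `<=` unr_closure E.
Proof. by move=> x Ex; exists 1%N => // s [_ sE] _; apply: sE. Qed.

Lemma unr_level_dvd r i x : unr_level E r x -> unr_level E (r * i) x.
Proof. by move=> xr s sE fs; apply: xr => //; apply: fixes_mu_dvd fs. Qed.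

Lemma unr_level_subext r : subext iota (unr_level E r).
Proof.
have -> : unr_level E r = [set x | forall s, (absgal E s /\ fixes_mu r s) -> s x = x].
  by apply/seteqP; split=> x xf; [move=> s [sE fs]; apply: xf | move=> s sE fs; apply: xf].
by apply: subext_fixed => s [sE _]; apply: absgal_base Es sE.
Qed.

Lemma unr_level_common x y : unr_closure E x -> unr_closure E y ->
  exists r, [/\ (0 < r)%N, unr_level E r x & unr_level E r y].
Proof.
move=> [r r0 xr] [r' r'0 yr]; exists (r * r')%N; rewrite muln_gt0 r0; split=> //.
  exact: unr_level_dvd.
by rewrite mulnC; apply: unr_level_dvd.
Qed.

Lemma unr_closure_subext : subext iota (unr_closure E).
Proof.
split.
- by move=> x /(base_sub_subext Es) /sub_unr_closure.
- move=> x y Ux Uy; have [r [r0 xr yr]] := unr_level_common Ux Uy; exists r => //.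
  exact: (subextB (unr_level_subext r)).
- move=> x y Ux Uy; have [r [r0 xr yr]] := unr_level_common Ux Uy; exists r => //.
  exact: (subextM (unr_level_subext r)).
- by move=> x [r r0 xr]; exists r => //; apply: (subextV (unr_level_subext r)).
Qed.

Lemma mem_unr_mu r z : (0 < r)%N -> z ^+ (p ^ r) = z -> unr_closure E z.
Proof. by move=> r0 zr; exists r => // s _; apply. Qed.

Lemma unr_closure_normal : normal_over E (unr_closure E).
Proof.
move=> s sE x [r r0 xr]; exists r => // t tE ft.
have [s' [s'E sK s'K]] := absgal_inv sE.
have h := xr (s' \o (t \o s) : auto) (absgal_comp s'E (absgal_comp tE sE)).
rewrite -[RHS](_ : s (s' (t (s x))) = _); first by rewrite s'K.
by rewrite [s' _]h // => z zr /=; rewrite ft ?mu_rmorph // sK.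
Qed.

(* A trace of zeta^k x has the same value as x: the conjugates of zeta are incongruent, so
   x is an integral combination of these traces by Lagrange interpolation. *)
Lemma unr_closure_value x : unr_closure E x -> exists2 y, E y & v y = v x.
Proof.
have [->|x0] := eqVneq x 0; first by exists 0; first exact: (subext_nat Es 0).
move=> [r r0 xr]; have [zeta [zr gen]] := mu_gen r0.
have G_K s : absgal E s -> absgal (base_field iota) s by apply: absgal_base.
have vG s y : absgal E s -> v (s y) = v y by move=> /G_K; apply: v_gal.
have z1 := teich_le1 va p_prime r0 zr.
pose xs := [:: zeta; x].
have [os [uos osP]] := finite_orbit Kb_alg G_K xs.
pose T k := \sum_(ys <- os) ys`_0 ^+ k * ys`_1.
have TE k : E (T k).
  apply: (fixed_absgal Kb_alg K_char0 Es) => g gE; rewrite rmorph_sum.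
  rewrite -[RHS](orbit_big (@absgal_comp _ E) _ (fun ys : seq Kb => ys`_0 ^+ k * ys`_1) uos gE osP).
  apply: eq_big_seq => ys /osP [s sE ->] /=.
  by rewrite rmorphM rmorphXn.
have vT k : v (T k) <= v x.
  rewrite /T big_seq; apply: absv_sum_le; rewrite ?(absv_ge0 va) // => ys /osP [s sE ->] /=.
  rewrite (absvM va) (absvX va) !vG // ler_piMl ?(absv_ge0 va) //.
  by rewrite exprn_ile1 // (absv_ge0 va).
(* The polynomial g vanishes at s zeta for every conjugate pair (s zeta, s x) other than (zeta, x),
   so that only g(zeta) x remains in the combination of traces below. *)
pose cs := [seq ys`_0 | ys <- os & ys != xs]; pose g := \prod_(a <- cs) ('X - a%:P).
have cs1 : {in cs, forall a, v a <= 1}.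
  move=> _ /mapP [ys + ->]; rewrite mem_filter => /andP [_ /osP [s sE ->]] /=.
  by rewrite vG.
have g1 := prod_XsubC_le1 cs1.
have xs_os : xs \in os.
  by apply/osP; exists (idfun : auto); [apply: absgal_id | rewrite map_id].
have gT : \sum_(k < size g) g`_k * T k = g.[zeta] * x.
  transitivity (\sum_(ys <- os) g.[ys`_0] * ys`_1).
    under eq_bigr do rewrite mulr_sumr; rewrite exchange_big /=.
    apply: eq_bigr => ys _; rewrite horner_coef mulr_suml.
    by apply: eq_bigr => k _; rewrite mulrA.
  rewrite (bigD1_seq xs) //= big_seq_cond big1 ?addr0 // => ys /andP [ys_os ysx].
  rewrite (_ : g.[_] = 0) ?mul0r //; apply/rootP; rewrite /g root_prod_XsubC.
  by apply/mapP; exists ys; rewrite // mem_filter ysx.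
(* If a root s zeta of g were congruent to zeta, then s would fix zeta, hence also x, which lies in
   level r; the pair would be (zeta, x) itself. *)
have vgz : v g.[zeta] = 1.
  rewrite horner_prod absv_prod // big_seq big1 // => a acs.
  have za1 : v (zeta - a) <= 1 by apply: absvB_le => //; apply: cs1.
  rewrite hornerXsubC; apply/le_anti; rewrite za1 /= leNgt; apply/negP => cza.
  have /mapP [ys + aE] := acs; rewrite mem_filter => /andP [/eqP ysx /osP [s sE ysE]].
  have sz : s zeta = zeta.
    apply/esym/(@teich_inj _ _ _ va _ p_prime vp r) => //; first exact: mu_rmorph.
    by move: cza; rewrite aE ysE.
  by case: ysx; rewrite ysE /= sz (xr s sE (fixes_mu_gen r0 gen sz)).
apply: contrapT => nT.
have : v (\sum_(k < size g) g`_k * T k) < v x.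
  apply: absv_sum_lt; rewrite ?absv_gt0 // => k _; rewrite (absvM va).
  apply: le_lt_trans (_ : v (T k) < _).
    by rewrite ler_piMl ?(absv_ge0 va).
  by rewrite lt_neqAle vT andbT; apply/eqP => e; apply: nT; exists (T k).
by rewrite gT (absvM va) vgz mul1r ltxx.
Qed.

Lemma unr_closure_unramified : unramified iota v E (unr_closure E).
Proof.
by split; [| apply: unr_closure_subext | apply: sub_unr_closure | apply: unr_closure_value].
Qed.
End Closure.

(** A gap below 1 in the values, stated without a uniformizer. The exponent D lets it pass from K to
    L by taking norms, without extracting roots. *)
Definition discrete_on E := exists D rho, [/\ (0 < D)%N, 0 <= rho, rho < 1 &
  forall x, E x -> v x < 1 -> v x ^+ D <= rho].

(* Successive approximation of x by sums of terms e z with e in E and z in mu'. *)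
Lemma unramified_fixed E N s x : unramified iota v E N -> discrete_on E ->
  absgal E s -> (forall r, (0 < r)%N -> fixes_mu r s) -> N x -> s x = x.
Proof.
move=> [Es Ns EN vEN] [D [rho [D0 rho0 rho1 disc]]] sE fs Nx.
have sK := absgal_base Es sE.
have step u : N u -> v u = 1 -> exists z, [/\ N z, s z = z & v (u - z) ^+ D <= rho].
  move=> Nu u1; have u_le1 : v u <= 1 by rewrite u1.
  have [r [z [r0 zr uz]]] := teich_exists va p_prime u_le1 (res_alg u_le1).
  exists z.
  (* An automorphism over N fixes u, so it sends z to a Teichmüller representative congruent to z,
     which is z. *)
  have Nz : N z.
    apply: (fixed_absgal Kb_alg K_char0 Ns) => g gN.
    apply: (@teich_inj _ _ _ va _ p_prime vp r) => //; first exact: mu_rmorph.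
    apply: (@vcong_trans _ _ _ va u) => //.
    rewrite /vcong -(gN.2 u Nu).
    by rewrite -rmorphB v_gal 1?absv_dist //; apply: absgal_base gN.
  split=> //; first exact: (fs r).
  have [e Ee ve] := vEN _ (subextB Ns Nu Nz).
  by rewrite -ve; apply: disc; rewrite // ve.
have approx k : exists y, [/\ N y, s y = y & v (x - y) ^+ D <= rho ^+ k * v x ^+ D].
  elim: k => [|k [y [Ny sy xy]]].
    by exists 0; rewrite rmorph0 subr0 expr0 mul1r; split=> //; apply: (subext_nat Ns 0).
  have [xy0|xy0] := eqVneq (x - y) 0.
    exists y; split=> //; rewrite xy0 absv0 // expr0n gtn_eqF //.
    by rewrite mulr_ge0 ?exprn_ge0 ?(absv_ge0 va).
  have [e Ee ve] := vEN _ (subextB Ns Nx Ny).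
  have e0 : e != 0.
    by apply: contraNneq xy0 => e0; apply/eqP/(absv_eq0 va); rewrite -ve e0 absv0.
  have [||z [Nz sz uz]] := step ((x - y) / e).
  - by apply: (subextM Ns (subextB Ns Nx Ny)); apply: (subextV Ns); apply: EN.
  - by rewrite (absvM va) (absvV va) ve mulfV // gt_eqF ?absv_gt0.
  exists (y + e * z); split.
  - by apply: (subextD Ns) => //; apply: (subextM Ns) => //; apply: EN.
  - by rewrite rmorphD rmorphM sy sz sE.2.
  have -> : x - (y + e * z) = e * ((x - y) / e - z).
    by rewrite mulrBr [e * (_ / _)]mulrC divfK // opprD addrA.
  rewrite (absvM va) exprMn exprS -mulrA mulrC ler_pM ?exprn_ge0 ?(absv_ge0 va) //.
  by rewrite ve.
apply/eqP; rewrite -subr_eq0; apply: contraT => sx0.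
have vs0 : 0 < v (s x - x) ^+ D by rewrite exprn_gt0 ?absv_gt0.
(* Since s fixes each approximation y, the difference s x - x equals s (x - y) - (x - y) and is
   bounded by v (x - y). Were it nonzero, the powers of rho would be bounded away from 0. *)
suff : 1 <= rho by rewrite leNgt rho1.
apply: (@ler_of_expr_bound _ _ _ (v x ^+ D / v (s x - x) ^+ D)) => // k.
rewrite expr1n mulrAC ler_pdivlMr // mul1r.
have [y [_ sy xy]] := approx k; rewrite mulrC; apply: le_trans xy.
have -> : s x - x = s (x - y) - (x - y) by rewrite rmorphB sy opprB addrA subrK.
by rewrite lerXn2r ?nnegrE ?(absv_ge0 va) // absvB_le // v_gal.
Qed.

Lemma unramified_sub_closure N : discrete_on (base_field iota) ->
  unramified iota v (base_field iota) N -> N `<=` unr_closure (base_field iota).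
Proof.
move=> disc Nu x Nx; apply: (fixed_absgal Kb_alg K_char0).
  exact: unr_closure_subext (subext_base_field iota).
move=> s sU; have sK := absgal_base (unr_closure_subext (subext_base_field iota)) sU.
apply: (unramified_fixed Nu disc sK _ Nx) => r r0 z zr.
by apply: sU.2; apply: mem_unr_mu zr.
Qed.

Lemma absgal_mu_comm s t r z : absgal (base_field iota) s -> absgal (base_field iota) t ->
  (0 < r)%N -> z ^+ (p ^ r) = z -> s (t z) = t (s z).
Proof.
move=> sG tG r0 zr; have [i Hi] := absgal_mu sG r0; have [j Hj] := absgal_mu tG r0.
by rewrite (Hi z) // (Hj z) // rmorphXn rmorphXn Hi // Hj // exprAC.
Qed.

Lemma absgal_unr_comm s t x : absgal (base_field iota) s -> absgal (base_field iota) t ->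
  unr_closure (base_field iota) x -> s (t x) = t (s x).
Proof.
move=> sG tG [r r0 xr].
apply: (unr_level_agree (s := s \o t : auto) (t := t \o s : auto) _ _ _ xr);
  try exact: absgal_comp.
by move=> z zr /=; apply: absgal_mu_comm zr.
Qed.

(* The image of absgal E in the automorphism group of mu_r lies in the cyclic group generated
   by the p-th power map. *)
Lemma absgal_mu_cyclic E r : subext iota E -> (0 < r)%N -> exists s0, absgal E s0 /\
  forall s, absgal E s -> exists k, forall z, z ^+ (p ^ r) = z -> s z = iter k s0 z.
Proof.
move=> Es r0; have [zeta [zr gen]] := mu_gen r0.
(* The least positive exponent i0 for which an element of Gal(Kb/E) acts as z -> z^(p^i0) gives the
   generator, by Euclidean division. The exponent r, realized by the identity, shows that there is
   one. *)
pose Q i := (0 < i)%N && `[< exists2 s, absgal E s & s zeta = zeta ^+ (p ^ i) >].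
have exQ : exists i, Q i.
  exists r; rewrite /Q r0; apply/asboolP; exists (idfun : auto); last by rewrite zr.
  exact: absgal_id.
case: (ex_minnP exQ) => i0 /andP [i00 /asboolP [s0 s0E s0z]] min.
exists s0; split=> // s sE; have sG := absgal_base Es sE.
have [i Hi] := absgal_mu sG r0; exists (i %/ i0)%N.
have [t [tE tP]] := absgal_iter (i %/ i0) s0E.
have itz k y : iter k s0 (zeta ^+ y) = zeta ^+ (p ^ (i0 * k) * y).
  elim: k => [|k IH] /=; first by rewrite muln0 mul1n.
  by rewrite IH rmorphXn s0z -exprM mulnA -expnD mulnS.
have [t' [t'E tK t'K]] := absgal_inv tE.
have tz : t' (s zeta) = zeta ^+ (p ^ (i %% i0)).
  rewrite -[RHS]tK tP itz Hi //; congr (t' (_ ^+ _)).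
  by rewrite -expnD mulnC -divn_eq.
have imod : (i %% i0 = 0)%N.
  apply/eqP; rewrite -leqn0 leqNgt; apply/negP => im.
  have := min (i %% i0)%N; rewrite leqNgt ltn_pmod // => h; suff : false by []; apply: h.
  by rewrite /Q im; apply/asboolP; exists (t' \o s : auto) => //; apply: absgal_comp.
have sz : s zeta = t zeta by rewrite -[s zeta]t'K tz imod expn0 expr1.
move=> z zr'; rewrite -tP; have [->|[l ->]] := gen z zr'; first by rewrite !rmorph0.
by rewrite !rmorphXn sz.
Qed.
End Unramified.

(** * Galois action on points *)

Section Points.
Variables (K : fieldType) (Kb : closedFieldType) (iota : {rmorphism K -> Kb}).
Local Notation auto := {rmorphism Kb -> Kb}.
Implicit Types (s t : auto) (E : set Kb).

Lemma mmap_rmorph n s (x : 'I_n -> Kb) (q : {mpoly K[n]}) : absgal (base_field iota) s ->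
  s (mmap iota x q) = mmap iota (fun i => s (x i)) q.
Proof.
case=> _ sK; rewrite /mmap rmorph_sum; apply: eq_bigr => m _; rewrite rmorphM /=.
congr (_ * _); first by rewrite sK //; exists q@_m.
by rewrite /mmap1 rmorph_prod; apply: eq_bigr => i _; rewrite rmorphXn.
Qed.

(** Proportional normalized vectors have their leading 1 at the same index, which forces c = 1. *)
Lemma ppoint_eq n (P Q : ppoint Kb n) c : (forall i, coords P i = c * coords Q i) -> P = Q.
Proof.
move=> PQ; have /existsP [a /andP [/eqP Pa /forallP P0]] := valP P.
have /existsP [b /andP [/eqP Qb /forallP Q0]] := valP Q.
have ab : a = b.
  apply/val_inj/eqP; rewrite eqn_leq; apply/andP; split; rewrite leqNgt; apply/negP => lt.
    have := PQ b; rewrite /coords Qb (eqP (implyP (P0 b) lt)) mulr1 => c0.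
    by have := PQ a; rewrite /coords Pa -c0 mul0r => /eqP; rewrite oner_eq0.
  by have := PQ a; rewrite /coords Pa (eqP (implyP (Q0 a) lt)) mulr0 => /eqP; rewrite oner_eq0.
have c1 : c = 1 by have := PQ a; rewrite /coords Pa ab Qb mulr1.
apply/val_inj/rowP => i; have := PQ i; rewrite c1 mul1r; exact.
Qed.

Lemma homog_coords_uniq n (P Q : ppoint Kb n) y : homog_coords P y -> homog_coords Q y -> P = Q.
Proof.
move=> [c c0 Py] [d d0 Qy]; apply: (@ppoint_eq _ _ _ (c^-1 * d)) => i.
by apply: (mulfI c0); rewrite -Py mulrA mulVKf // Qy.
Qed.

Lemma coords_map n s (P : ppoint Kb n) i : coords (ppoint_map s P) i = s (coords P i).
Proof. by rewrite /coords mxE. Qed.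

Lemma homog_coords_map n s (P : ppoint Kb n) y :
  homog_coords P y -> homog_coords (ppoint_map s P) (fun i => s (y i)).
Proof.
move=> [c c0 Py]; exists (s c); first by rewrite fmorph_eq0.
by move=> i; rewrite Py rmorphM coords_map.
Qed.

Section Action.
Variable A : abelian_variety iota.
Local Notation e := (@av_emb _ _ _ A).

Lemma av_act_coords s (P : A) i : absgal (base_field iota) s ->
  coords (e (av_act s P)) i = s (coords (e P) i).
Proof. by move=> sG; rewrite av_actE // coords_map. Qed.

Lemma av_coords_inj (P Q : A) : (forall i, coords (e P) i = coords (e Q) i) -> P = Q.
Proof. by move=> PQ; apply/av_inj/(@ppoint_eq _ _ _ 1) => i; rewrite PQ mul1r. Qed.

Lemma av_act_eq s t (P : A) : absgal (base_field iota) s -> absgal (base_field iota) t ->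
  (forall i, s (coords (e P) i) = t (coords (e P) i)) -> av_act s P = av_act t P.
Proof. by move=> sG tG st; apply: av_coords_inj => i; rewrite !av_act_coords. Qed.

Lemma av_act_id (P : A) : av_act (idfun : auto) P = P.
Proof. by apply: av_coords_inj => i; rewrite av_act_coords //; apply: absgal_id. Qed.

Lemma av_act_comp s t (P : A) : absgal (base_field iota) s -> absgal (base_field iota) t ->
  av_act (s \o t : auto) P = av_act s (av_act t P).
Proof.
move=> sG tG; apply: av_coords_inj => i; rewrite !av_act_coords //.
exact: absgal_comp.
Qed.

(** Near (P, Q) addition is given by polynomials over K, which commute with s. As s preserves their
    non-vanishing, the same polynomials compute the sum at (sP, sQ). *)
Lemma av_actD s (P Q : A) : absgal (base_field iota) s ->
  av_act s (P + Q) = av_act s P + av_act s Q.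
Proof.
move=> sG; apply: av_inj.
have [d1 [d2 [g [_ [j gj] gP]]]] := av_add (a := A) P Q.
have e2 l : s (eval2 iota (e P) (e Q) (g l)) = eval2 iota (e (av_act s P)) (e (av_act s Q)) (g l).
  rewrite /eval2 mmap_rmorph //; congr (mmap _ _ _); apply/funext => i.
  by rewrite !av_actE // -map_row_mx [RHS]mxE.
have h1 := homog_coords_map s (gP P Q (ex_intro _ j gj)).
have h2 := gP (av_act s P) (av_act s Q).
rewrite (funext e2) in h1; rewrite av_actE //; apply: (homog_coords_uniq h1).
by apply: h2; exists j; rewrite -e2 fmorph_eq0.
Qed.

Lemma av_act0 s : absgal (base_field iota) s -> av_act s 0 = 0 :> A.
Proof.
by move=> sG; apply: (addrI (av_act s 0)); rewrite -av_actD // !addr0.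
Qed.

Lemma av_actN s (P : A) : absgal (base_field iota) s -> av_act s (- P) = - av_act s P.
Proof.
by move=> sG; apply: (addrI (av_act s P)); rewrite -av_actD // !subrr av_act0.
Qed.

Lemma av_actB s (P Q : A) : absgal (base_field iota) s ->
  av_act s (P - Q) = av_act s P - av_act s Q.
Proof. by move=> sG; rewrite av_actD // av_actN. Qed.

Lemma rational_pts_sub E E' : E `<=` E' -> rational_pts (A := A) E `<=` rational_pts E'.
Proof. by move=> EE P PE i; apply: EE. Qed.

Lemma rational_act E s (P : A) : subext iota E -> absgal E s -> rational_pts E P -> av_act s P = P.
Proof.
move=> Es sE PE; have sG := absgal_base Es sE.
by apply: av_coords_inj => i; rewrite av_act_coords // sE.2.
Qed.

Hypothesis Kb_alg : forall x, algebraicOver iota x.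
Hypothesis K_char0 : [pchar K] =i pred0.

Lemma act_rational E (P : A) : subext iota E -> (forall s, absgal E s -> av_act s P = P) ->
  rational_pts E P.
Proof.
move=> Es fP i; apply: (fixed_absgal Kb_alg K_char0 Es) => s sE.
by rewrite -av_act_coords ?fP //; apply: absgal_base sE.
Qed.

Lemma rational_ptsB E (P Q : A) : subext iota E ->
  rational_pts E P -> rational_pts E Q -> rational_pts E (P - Q).
Proof.
move=> Es PE QE; apply: act_rational => // s sE.
by rewrite av_actB ?(rational_act Es sE) //; apply: absgal_base sE.
Qed.

Lemma rational_pts0 E : subext iota E -> rational_pts E (0 : A).
Proof. by move=> Es; apply: act_rational => // s sE; rewrite av_act0 //; apply: absgal_base sE. Qed.
End Action.

Lemma isogeny_act (A A' : abelian_variety iota) (phi : {additive A -> A'}) s (P : A) :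
  isogeny phi -> absgal (base_field iota) s -> phi (av_act s P) = av_act s (phi P).
Proof.
move=> [reg _ _] sG; apply: av_inj; have [d [g [_ [j gj] gP]]] := reg P.
have e1 l : s (mmap iota (coords (av_emb P)) (g l)) = mmap iota (coords (av_emb (av_act s P))) (g l).
  rewrite mmap_rmorph //; congr (mmap _ _ _); apply/funext => i.
  by rewrite av_act_coords.
have h1 := homog_coords_map s (gP P (ex_intro _ j gj)).
have h2 := gP (av_act s P).
rewrite (funext e1) in h1; rewrite [RHS]av_actE //; apply: (homog_coords_uniq _ h1).
by apply: h2; exists j; rewrite -e1 fmorph_eq0.
Qed.
End Points.

(** * Independence of characters and the degree of a cyclic extension *)

Lemma characters_indep (k : fieldType) (N : set k) n (sigma : nat -> k -> k) (c : nat -> k) :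
  (forall i, sigma i 1 = 1) -> (forall i x y, sigma i (x * y) = sigma i x * sigma i y) ->
  N 1 -> (forall x y, N x -> N y -> N (x * y)) ->
  (forall i j, (i < j < n)%N -> exists2 x, N x & sigma i x != sigma j x) ->
  (forall x, N x -> \sum_(i < n) c i * sigma i x = 0) -> forall i, (i < n)%N -> c i = 0.
Proof.
move=> s1 sM N1 NM; elim: n c => [//|n IH] c dist c0.
have cn i : (i < n)%N -> c i = 0.
  move=> i_n; have [|y Ny sy] := dist i n; first by rewrite i_n /=.
  have /eqP : c i * (sigma i y - sigma n y) = 0; last first.
    by rewrite mulf_eq0 subr_eq0 (negPf sy) orbF => /eqP.
  apply: (IH (fun l => c l * (sigma l y - sigma n y))) => //.
    by move=> a b /andP [ab bn]; apply: dist; rewrite ab /=; apply: ltnW.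
  (* Subtracting sigma_n(y) times the relation at x from the relation at y x eliminates the last
     character. *)
  move=> x Nx; have e1 := c0 _ (NM _ _ Ny Nx); have e2 := c0 _ Nx.
  have : \sum_(l < n.+1) c l * sigma l (y * x) - sigma n y * \sum_(l < n.+1) c l * sigma l x = 0.
    by rewrite e1 e2 mulr0 subr0.
  rewrite !big_ord_recr /= mulrDr sM opprD addrACA.
  have -> : c n * (sigma n y * sigma n x) - sigma n y * (c n * sigma n x) = 0 by ring.
  rewrite addr0 mulr_sumr -sumrB => h0; rewrite -[RHS]h0.
  by apply: eq_bigr => l _; rewrite sM; ring.
move=> i; rewrite ltnS leq_eqVlt => /orP [/eqP ->|/cn //].
have := c0 1 N1; rewrite big_ord_recr /= big1 ?add0r ?s1 ?mulr1 //.
by move=> l _; rewrite cn ?mul0r.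
Qed.

Lemma kernel_row (k : fieldType) a b (B : 'M[k]_(a, b)) : (b < a)%N ->
  exists2 u : 'rV_a, u != 0 & u *m B = 0.
Proof.
move=> ba; have : kermx B != 0.
  by rewrite -mxrank_eq0 mxrank_ker subn_eq0 -ltnNge; apply: leq_ltn_trans (rank_leq_col B) ba.
case/rowV0Pn => u uB u0; exists u => //; exact/sub_kermxP.
Qed.

Section CyclicDegree.
Variables (K : fieldType) (Kb : closedFieldType) (iota : {rmorphism K -> Kb}).
Hypothesis Kb_alg : forall x, algebraicOver iota x.
Hypothesis K_char0 : [pchar K] =i pred0.
Variables (E N : set Kb) (m : nat) (s0 : {rmorphism Kb -> Kb}).
Hypotheses (Es : subext iota E) (Ns : subext iota N) (mN : has_degree E N m).
Hypotheses (s0E : absgal E s0).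
Hypothesis s0_gen : forall s, absgal E s -> exists k, forall x, N x -> s x = iter k s0 x.

Lemma iter_rmorphM k x y : iter k s0 (x * y) = iter k s0 x * iter k s0 y.
Proof. by elim: k => //= k ->; rewrite rmorphM. Qed.

Lemma iter_rmorph1 k : iter k s0 1 = 1.
Proof. by elim: k => //= k ->; rewrite rmorph1. Qed.

Lemma iter_rmorph_sum k n (f : 'I_n -> Kb) : iter k s0 (\sum_i f i) = \sum_i iter k s0 (f i).
Proof. by elim: k => //= k ->; rewrite rmorph_sum. Qed.

Lemma iter_fixes k x : E x -> iter k s0 x = x.
Proof. by move=> Ex; elim: k => //= k ->; apply: s0E.2. Qed.

Lemma iter_inj k : injective (iter k s0).
Proof. by elim: k => //= k IH x y /fmorph_inj /IH. Qed.

Section Order.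
Variable o : nat.
Hypotheses (o_gt0 : (0 < o)%N) (o_fix : forall x, N x -> iter o s0 x = x).
Hypothesis o_min : forall k, (0 < k)%N -> (forall x, N x -> iter k s0 x = x) -> (o <= k)%N.

Lemma iter_mod_order k x : N x -> iter k s0 x = iter (k %% o)%N s0 x.
Proof.
move=> Nx; rewrite {1}(divn_eq k o) addnC iterD; congr iter.
by elim: (k %/ o)%N => // q IH; rewrite mulSn addnC iterD o_fix.
Qed.

(** If o > m, the o powers of s0 satisfy a linear relation on the m basis vectors, hence on all of N
    by E-linearity, contrary to the independence of characters. *)
Lemma order_le_degree : (o <= m)%N.
Proof.
have [b [bN bspan bfree]] := mN; rewrite leqNgt; apply/negP => mo.
have [u u0 uB] := kernel_row (\matrix_(j < o, i < m) iter j s0 (b i)) mo.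
case/negP: u0; apply/eqP/rowP => j; rewrite mxE.
pose c k := if insub k is Some i then u 0 i else 0.
have cE (i : 'I_o) : c i = u 0 i by rewrite /c valK.
rewrite -cE; apply: (@characters_indep _ N o (fun k => iter k s0)) => //.
- by move=> k; apply: iter_rmorph1.
- by move=> k x y; apply: iter_rmorphM.
- exact: (subext_nat Ns 1).
- by move=> x y; apply: (subextM Ns).
- move=> i l /andP [il lo]; apply: contrapT => h.
  have : (o <= l - i)%N; last by rewrite leqNgt (leq_ltn_trans (leq_subr _ _)).
  apply: o_min; first by rewrite subn_gt0.
  move=> x Nx; apply: (@iter_inj i); rewrite -iterD subnKC ?(ltnW il) //.
  by apply: contrapT => xil; apply: h; exists x => //; apply/eqP/nesym.
move=> x /bspan [d dE ->].
under eq_bigr => l _ do rewrite cE iter_rmorph_sum mulr_sumr.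
rewrite exchange_big big1 //= => i _.
have := congr1 (fun w : 'rV_m => w 0 i) uB; rewrite !mxE => uBi.
rewrite -[RHS](mulr0 (d i)) -[in RHS]uBi mulr_sumr; apply: eq_bigr => l _.
by rewrite mxE iter_rmorphM iter_fixes // mulrCA.
Qed.

(* A solution c of the system B c = 0, normalised by c_i = 1, has a trace over E which is
   again a solution, now in E, and whose i-th coordinate is a positive integer. *)
Lemma degree_le_order : (m <= o)%N.
Proof.
have [b [bN bspan bfree]] := mN; rewrite leqNgt; apply/negP => om.
have [u u0 uB] := kernel_row (\matrix_(i < m, j < o) iter j s0 (b i)) om.
have [i0 ui0] : exists i0, u 0 i0 != 0.
  apply: contrapT => h; case/negP: u0; apply/eqP/rowP => i; rewrite mxE.
  by apply/eqP; apply: contrapT => ui; apply: h; exists i; apply/negP.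
have uBk k : \sum_i u 0 i * iter k s0 (b i) = 0.
  have := congr1 (fun w : 'rV_o => w 0 (Ordinal (ltn_pmod k o_gt0))) uB; rewrite !mxE => h; rewrite -[RHS]h.
  by apply: eq_bigr => i _; rewrite mxE /= iter_mod_order.
pose c i := u 0 i / u 0 i0.
have cB k : \sum_i c i * iter k s0 (b i) = 0.
  rewrite -[RHS](mulr0 (u 0 i0)^-1) -[in RHS](uBk k) mulr_sumr; apply: eq_bigr => i _.
  by rewrite /c [u 0 i / _]mulrC mulrA.
pose cs := [seq c i | i <- enum 'I_m].
have csE (i : 'I_m) : cs`_i = c i by rewrite (nth_map i0) ?size_enum_ord ?nth_ord_enum.
have G_K s : absgal E s -> absgal (base_field iota) s by apply: absgal_base.
have [os [uos osP]] := finite_orbit Kb_alg G_K cs.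
have nth_os s (i : 'I_m) : (map s cs)`_i = s (c i).
  by rewrite (nth_map 0) ?csE // size_map size_enum_ord.
pose S (i : 'I_m) := \sum_(ys <- os) ys`_i.
have SE i : E (S i).
  apply: (fixed_absgal Kb_alg K_char0 Es) => g gE; rewrite rmorph_sum.
  rewrite -[RHS](orbit_big (@absgal_comp _ E) _ (fun ys : seq Kb => ys`_i) uos gE osP).
  apply: eq_big_seq => ys /osP [s sE ->].
  by rewrite -map_comp !nth_os.
have Sb : \sum_i S i * b i = 0.
  under eq_bigr do rewrite mulr_suml; rewrite exchange_big /= big_seq big1 // => ys /osP [s sE ->].
  have [t [tE st ts]] := absgal_inv sE; have [k tk] := s0_gen tE.
  rewrite -[RHS](rmorph0 s) -[in RHS](cB k) rmorph_sum; apply: eq_bigr => i _.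
  by rewrite nth_os [RHS]rmorphM -(tk _ (bN i)) ts.
have /eqP := bfree S SE Sb i0; apply/negP.
rewrite /S (eq_big_seq (fun=> 1)); last first.
  by move=> ys /osP [s sE ->]; rewrite nth_os /c mulfV // rmorph1.
rewrite big_const_seq count_predT iter_addr_0 ((pcharf0P _).1 (Kb_char0 iota K_char0)).
have : map (idfun : {rmorphism Kb -> Kb}) cs \in os.
  by apply/osP; exists (idfun : {rmorphism Kb -> Kb}) => //; apply: absgal_id.
by case: (os).
Qed.
End Order.

(** The degree m equals the order o of s0 on N, and s0^k is trivial on N only if o divides k. *)
Lemma cyclic_degree_dvd k : (forall x, N x -> iter k s0 x = x) -> (m %| k)%N.
Proof.
move=> k_fix; have [->|k0] := posnP k; first exact: dvdn0.
pose Q o := (0 < o)%N && `[< forall x, N x -> iter o s0 x = x >].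
have exQ : exists o, Q o by exists k; rewrite /Q k0; apply/asboolP.
case: (ex_minnP exQ) => o /andP [o0 /asboolP ofix] min.
have omin i : (0 < i)%N -> (forall x, N x -> iter i s0 x = x) -> (o <= i)%N.
  by move=> i0 ifix; apply: min; rewrite /Q i0; apply/asboolP.
have -> : m = o.
  by apply/eqP; rewrite eqn_leq degree_le_order // order_le_degree.
rewrite /dvdn -leqn0 leqNgt; apply/negP => r0.
have := omin _ r0; rewrite leqNgt ltn_pmod // => h; suff : false by []; apply: h.
by move=> x Nx; rewrite -iter_mod_order // k_fix.
Qed.
End CyclicDegree.

(** * The field generated by the kernel of the isogeny *)

Section KernelField.
Variables (R : realType) (K : fieldType) (Kb : closedFieldType).
Variables (iota : {rmorphism K -> Kb}) (v : Kb -> R) (p : nat).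
Hypothesis Kb_alg : forall x, algebraicOver iota x.
Hypothesis K_char0 : [pchar K] =i pred0.
Hypotheses (va : nonarch_absv v) (p_prime : prime p) (vp : v p%:R < 1).
Hypothesis v_gal : forall s x, absgal (base_field iota) s -> v (s x) = v x.
Hypothesis res_alg : forall x, v x <= 1 -> resalg v p x.
Hypothesis K_discrete : discrete_on v (base_field iota).
Local Notation auto := {rmorphism Kb -> Kb}.
Local Notation G_K := (absgal (base_field iota)).
Local Notation U := (unr_closure p (base_field iota)).
Implicit Types (s t g h : auto).
Variables (A A' : abelian_variety iota) (phi : {additive A -> A'}).
Hypothesis phi_isogeny : isogeny phi.
Local Notation T := (ker_pts phi).
Local Notation L := (adjoin_pts T).
Local Notation e := (@av_emb _ _ _ A).

Lemma ker_act s P : G_K s -> T P -> T (av_act s P).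
Proof. by move=> sG P0; rewrite /ker_pts /= isogeny_act // P0 av_act0. Qed.

Lemma L_subext : subext iota L.
Proof.
split.
- by move=> x Kx E Es _; apply: base_sub_subext Es _ Kx.
- by move=> x y Lx Ly E Es TE; apply: subextB Es _ _ (Lx E Es TE) (Ly E Es TE).
- by move=> x y Lx Ly E Es TE; apply: subextM Es _ _ (Lx E Es TE) (Ly E Es TE).
- by move=> x Lx E Es TE; apply: subextV Es _ (Lx E Es TE).
Qed.

Lemma ker_rational_L P : T P -> rational_pts L P.
Proof. by move=> TP i E Es TE; apply: TE. Qed.

Lemma absgal_L_ker s P : absgal L s -> T P -> av_act s P = P.
Proof. by move=> sL TP; apply: (rational_act L_subext sL); apply: ker_rational_L. Qed.

(** The fixed field of s is one of the subextensions over which all points of the kernel are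
    rational, so it contains L. *)
Lemma ker_fixed_L s x : G_K s -> (forall P, T P -> av_act s P = P) -> L x -> s x = x.
Proof.
move=> sG sT Lx; apply: (Lx [set x | forall t, [set s] t -> t x = x]) (erefl _).
  by apply: subext_fixed => _ ->.
by move=> P TP i _ ->; rewrite -av_act_coords ?sT.
Qed.

Lemma ker_agree_L s t x : G_K s -> G_K t ->
  (forall P, T P -> av_act s P = av_act t P) -> L x -> s x = t x.
Proof.
move=> sG tG st Lx; have [t' [t'G tK t'K]] := absgal_inv tG.
have : (t' \o s : auto) x = x.
  apply: ker_fixed_L Lx; first exact: absgal_comp.
  move=> P TP; rewrite av_act_comp // st // -av_act_comp //.
  by rewrite -[RHS](av_act_id P); apply: av_act_eq => [||i /=]; [apply: absgal_comp | apply: absgal_id | rewrite tK].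
by move=> /= h; rewrite -[RHS](congr1 t h) t'K.
Qed.

Lemma absgal_L_G_K s : absgal L s -> G_K s.
Proof. exact: absgal_base L_subext. Qed.

Lemma L_normal s x : G_K s -> L x -> L (s x).
Proof.
move=> sG Lx; apply: (fixed_absgal Kb_alg K_char0 L_subext) => g gL.
have gG := absgal_L_G_K gL.
apply: (@ker_agree_L (g \o s : auto) s) => //; first exact: absgal_comp.
by move=> P TP; rewrite av_act_comp // (absgal_L_ker gL) //; apply: ker_act.
Qed.

(** The coordinates of the finitely many points of the kernel generate L, so the action on L is
    controlled by one finite tuple. The list given by the isogeny may contain other points, hence
    the filter. *)
Lemma ker_coords : exists cs : seq Kb, (forall x, x \in cs -> L x) /\
  forall s t, G_K s -> G_K t -> map s cs = map t cs -> forall x, L x -> s x = t x.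
Proof.
have [ts tsP] := isog_finite phi_isogeny.
exists [seq coords (e P) i | P <- [seq P <- ts | `[< T P >]], i <- enum 'I_(av_dim A).+1].
split.
  move=> _ /allpairsP [[P i] /= [+ _ ->]].
  by rewrite mem_filter => /andP [/asboolP TP _]; apply: ker_rational_L.
move=> s t sG tG /eq_in_map st x; apply: ker_agree_L => // P TP.
apply: av_act_eq => // i; apply: st; apply/allpairsP; exists (P, i); split=> //=.
  by rewrite mem_filter tsP // andbT; apply/asboolP.
by rewrite mem_enum.
Qed.

(* The norm to K of an element x of L has value v x ^ n with n independent of x. *)
Lemma L_discrete : discrete_on v L.
Proof.
have [cs [csL cs_agree]] := ker_coords.
have G_comp s t : G_K s -> G_K t -> G_K (s \o t : auto) by apply: absgal_comp.
have [os0 [uos0 os0P]] := finite_orbit Kb_alg (fun s sG => sG) cs.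
have [D [rho [D0 rho0 rho1 disc]]] := K_discrete.
have n0 : (0 < size os0)%N.
  have : map (idfun : auto) cs \in os0 by apply/os0P; exists (idfun : auto) => //; apply: absgal_id.
  by case: (os0).
exists (size os0 * D)%N, rho; split=> //; first by rewrite muln_gt0 n0.
move=> x Lx x1; have [os [uos osP]] := finite_orbit Kb_alg (fun s sG => sG) (x :: cs).
(* The images of [cs] determine the action on L, so conjugates of x :: cs correspond to conjugates
   of [cs]; this makes the exponent of the norm independent of x. *)
have sz : size os = size os0.
  rewrite -(size_map behead); apply: perm_size; apply: uniq_perm => //.
    rewrite map_inj_in_uniq // => _ _ /osP [s sG ->] /osP [t tG ->] /= st.
    by rewrite st (cs_agree s t).
  move=> ys; apply/mapP/idP => [[_ /osP [s sG ->] ->]|/os0P [s sG ->]].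
    by apply/os0P; exists s.
  by exists (map s (x :: cs)) => //; apply/osP; exists s.
pose y := \prod_(ys <- os) ys`_0.
have Ky : base_field iota y.
  apply: (fixed_absgal Kb_alg K_char0 (subext_base_field iota)) => g gG; rewrite rmorph_prod.
  rewrite -[RHS](orbit_big G_comp _ (fun ys : seq Kb => ys`_0) uos gG osP).
  by apply: eq_big_seq => ys /osP [s sG ->].
have vy : v y = v x ^+ size os0.
  rewrite /y absv_prod // -sz (eq_big_seq (fun=> v x)).
    by rewrite big_const_seq count_predT iter_mulr_1.
  by move=> ys /osP [s sG ->] /=; rewrite v_gal.
by rewrite exprM -vy disc // vy exprn_ilt1 ?(absv_ge0 va) // -lt0n.
Qed.

Lemma mem_L_unr_unramified : unramified iota v (base_field iota) (L `&` U).
Proof.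
have Us := unr_closure_subext p (subext_base_field iota).
split.
- exact: subext_base_field.
- split.
  + by move=> x Kx; split; [apply: base_sub_subext L_subext _ Kx | apply: base_sub_subext Us _ Kx].
  + by move=> x y [Lx Ux] [Ly Uy]; split; [apply: subextB L_subext _ _ Lx Ly | apply: subextB Us _ _ Ux Uy].
  + by move=> x y [Lx Ux] [Ly Uy]; split; [apply: subextM L_subext _ _ Lx Ly | apply: subextM Us _ _ Ux Uy].
  + by move=> x [Lx Ux]; split; [apply: subextV L_subext _ Lx | apply: subextV Us _ Ux].
- by move=> x Kx; split; [apply: base_sub_subext L_subext _ Kx | apply: base_sub_subext Us _ Kx].
- move=> x [_ Ux].
  exact: (unr_closure_value Kb_alg K_char0 va p_prime vp v_gal (subext_base_field iota) Ux).
Qed.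

Definition inertia h := G_K h /\ forall r, (0 < r)%N -> fixes_mu p r h.

Lemma inertia_comp s t : inertia s -> inertia t -> inertia (s \o t : auto).
Proof.
move=> [sG sm] [tG tm]; split; first exact: absgal_comp.
by move=> r r0 z zr /=; rewrite (tm r) ?(sm r).
Qed.

Lemma inertia_inv s : inertia s -> exists t, [/\ inertia t, cancel s t & cancel t s].
Proof.
move=> [sG sm]; have [t [tG st ts]] := absgal_inv sG; exists t; split=> //; split=> //.
by move=> r r0 z zr; rewrite -{1}(sm r r0 z zr) st.
Qed.

Lemma inertia_absgal_U h : absgal U h -> inertia h.
Proof.
move=> hU; split; first exact: absgal_base (unr_closure_subext p (subext_base_field iota)) hU.
by move=> r r0 z zr; apply: hU.2; apply: mem_unr_mu zr.
Qed.

Lemma inertia_fixes_U h x : inertia h -> U x -> h x = x.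
Proof. by move=> [hG hm] [r r0]; apply=> //; apply: hm. Qed.

(* If cs generates L, then the coefficients of the polynomial with roots the inertia conjugates
   of (the polynomial with coefficients) cs are in L and fixed by inertia, hence by s. *)
Lemma inertia_lift s : absgal (L `&` U) s ->
  exists h, inertia h /\ forall x, L x -> h x = s x.
Proof.
move=> sE; have [_ Es _ _] := mem_L_unr_unramified; have sG := absgal_base Es sE.
have [cs [csL cs_agree]] := ker_coords.
have I_G h : inertia h -> G_K h by case.
have [os [uos osP]] := finite_orbit Kb_alg I_G cs.
(* A tuple is encoded as a polynomial in an auxiliary variable, so that one root of P describes a
   whole tuple of conjugates. *)
pose F (ys : seq Kb) : {poly {poly Kb}} := 'X - (Poly ys)%:P.
pose P := \prod_(ys <- os) F ys.
have map_Poly g (ys : seq Kb) : map_poly g (Poly ys) = Poly (map g ys).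
  apply/polyP => i; rewrite coef_map !coef_Poly.
  have [i_ys|ys_i] := ltnP i (size ys); first by rewrite (nth_map 0).
  by rewrite !nth_default ?size_map //; exact: (rmorph0 g).
have map_F g ys : map_poly (map_poly g) (F ys) = F (map g ys).
  by rewrite /F rmorphB /= map_polyX map_polyC /= map_Poly.
have map_P g : map_poly (map_poly g) P = \prod_(ys <- os) F (map g ys).
  by rewrite rmorph_prod; apply: eq_bigr => ys _; apply: map_F.
have P_L g : absgal L g -> map_poly (map_poly g) P = P.
  move=> gL; rewrite map_P; apply: eq_big_seq => ys /osP [h [hG _] ->]; congr (F _).
  rewrite -map_comp; apply/eq_in_map => x /csL Lx /=. apply: gL.2. apply: L_normal hG Lx.
have P_I g : inertia g -> map_poly (map_poly g) P = P.
  by move=> gI; rewrite map_P; apply: (orbit_big inertia_comp _ F uos gI osP).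
have P_s : map_poly (map_poly s) P = P.
  apply/polyP => i; apply/polyP => k; rewrite !coef_map /=; apply: sE.2; split.
    apply: (fixed_absgal Kb_alg K_char0 L_subext) => g gL.
    by rewrite -{2}(P_L g gL) !coef_map.
  apply: (fixed_absgal Kb_alg K_char0 (unr_closure_subext p (subext_base_field iota))) => g gU.
  by rewrite -{2}(P_I g (inertia_absgal_U gU)) !coef_map.
have cs_os : cs \in os.
  apply/osP; exists (idfun : auto); last by rewrite map_id.
  by apply: inertia_absgal_U; apply: absgal_id.
(* The tuple s(cs) is a root of the conjugate of P by s, which is P, so it equals h(cs) for some
   inertia element h. *)
have : P.[Poly (map s cs)] = 0.
  rewrite -P_s map_P horner_prod (big_rem cs) //= /F hornerXsubC subrr mul0r //.
rewrite /P horner_prod => /eqP; rewrite prodf_seq_eq0 => /hasP [ys /osP [h hI ->]] /=.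
rewrite /F hornerXsubC subr_eq0 => /eqP hs.
exists h; split=> //; apply: cs_agree; [by apply: I_G | by [] |].
apply: (@eq_from_nth _ 0) => [|i _]; first by rewrite !size_map.
by have := congr1 (fun q : {poly Kb} => q`_i) hs; rewrite !coef_Poly.
Qed.

Section Inertia.
Variables L' : set Kb.
Hypothesis L'_max : max_unramified iota v L L'.

Lemma L'_subext : subext iota L'. Proof. by case: L'_max => -[]. Qed.

Lemma L'_sub_U : L' `<=` U.
Proof.
case: L'_max => L'u _ _.
exact: (unramified_sub_closure Kb_alg K_char0 va p_prime vp v_gal res_alg K_discrete L'u).
Qed.

Lemma L_U_sub_L' : L `&` U `<=` L'.
Proof.
case: L'_max => _ _ L'max; apply: L'max; first exact: mem_L_unr_unramified.
by move=> x [].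
Qed.

Lemma inertia_absgal_L' h : inertia h -> absgal L' h.
Proof.
move=> hI; split; first by case: hI.1.
by move=> x /L'_sub_U; apply: inertia_fixes_U.
Qed.

(* H^1(Gal(L/L'), A[phi]) = 0 kills the restriction of the Kummer class to inertia. *)
Lemma kummer_inertia_split Q : H1_trivial L' L T ->
  rational_pts (base_field iota) (phi Q) -> unramified_hom v L (kummer Q) ->
  exists2 a, T a & forall h, inertia h -> av_act h (Q - a) = Q - a.
Proof.
move=> H1 PK [N [Nu _ Nf]].
(* The Kummer homomorphism on Gal(Kb/L) factors through the unramified extension N / L, and inertia
   elements over L fix N because L is discretely valued. *)
have Q_fix h : inertia h -> absgal L h -> av_act h Q = Q.
  move=> hI hL; have := Nf h (idfun : auto) hL (absgal_id L).
  rewrite /kummer av_act_id subrr => h0; apply/eqP; rewrite -subr_eq0; apply/eqP/h0.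
  move=> x Nx.
  exact: (unramified_fixed Kb_alg K_char0 va p_prime vp v_gal res_alg Nu L_discrete hL hI.2 Nx).
(* Elements of Gal(L/L') are lifted to inertia. On such lifts hQ depends only on the restriction of
   h to L, so the Kummer cocycle descends to Gal(L/L'). *)
have lift s : exists h, absgal L' s -> inertia h /\ forall x, L x -> h x = s x.
  have [sL'|nsL'] := EM (absgal L' s); last by exists s => /nsL'.
  have [|h Hh] := @inertia_lift s; last by exists h.
  exact: absgal_sub L_U_sub_L' sL'.
have [hh Hh] := choice lift.
have Q_agree h h' : inertia h -> inertia h' -> (forall x, L x -> h x = h' x) ->
    av_act h Q = av_act h' Q.
  move=> hI h'I hh'; have [k [kI h'k kh']] := inertia_inv h'I.
  have := Q_fix (k \o h : auto) (inertia_comp kI hI) => e1.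
  rewrite -[in RHS]e1; last first.
    split; first by case: (absgal_comp kI.1 hI.1).
    by move=> x Lx /=; rewrite hh' // h'k.
  have khG : G_K (k \o h : auto) by apply: absgal_comp; [exact: kI.1 | exact: hI.1].
  rewrite -av_act_comp //; last exact: h'I.1.
  apply: av_act_eq => [||i /=]; rewrite ?kh' //; first exact: hI.1.
  by apply: absgal_comp => //; exact: h'I.1.
have T_kum s : G_K s -> T (kummer Q s).
  move=> sG; rewrite /ker_pts /= /kummer raddfB isogeny_act //.
  by rewrite (rational_act (subext_base_field iota) sG PK) subrr.
have [|||a Ta Ha] := H1 (fun s => kummer Q (hh s)).
- by move=> s /Hh [[hG _] _]; apply: T_kum.
- move=> s t sL tL st; have [hsI hs] := Hh s sL; have [htI ht] := Hh t tL.
  by rewrite /kummer (Q_agree (hh s) (hh t)) // => x Lx; rewrite hs // ht // st.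
- move=> s t sL tL; have [hsI hs] := Hh s sL; have [htI ht] := Hh t tL.
  have stL : absgal L' (s \o t : auto) by apply: absgal_comp.
  have [hstI hst] := Hh _ stL.
  have sG := absgal_base L'_subext sL.
  have -> : av_act s (kummer Q (hh t)) = av_act (hh s) (kummer Q (hh t)).
    apply: av_act_eq => [//||i]; first exact: hsI.1.
    by rewrite hs //; apply: ker_rational_L; apply: T_kum; exact: htI.1.
  rewrite /kummer (Q_agree _ (hh s \o hh t : auto)) //; last first.
  + move=> x Lx; rewrite hst //= ht // hs //; apply: L_normal => //.
    exact: absgal_base L'_subext tL.
  + exact: inertia_comp.
  rewrite av_act_comp; [|exact: hsI.1|exact: htI.1].
  by rewrite av_actB; [rewrite [RHS]addrC addrA subrK | exact: hsI.1].
exists a => // h hI; have hL' := inertia_absgal_L' hI; have [hhI hhh] := Hh h hL'.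
have := Ha h hL'; rewrite /kummer (Q_agree (hh h) h) // => e1.
have hQ : av_act h Q = av_act h a - a + Q by rewrite -e1 subrK.
rewrite av_actB; last exact: hI.1.
by rewrite hQ addrAC [_ - a - _]addrAC subrr sub0r addrC.
Qed.
End Inertia.
End KernelField.

(** * The isomorphism *)

Section QuotientImages.
Variables (W V V' : zmodType) (a : {additive W -> V}) (b : {additive W -> V'}) (S : set W).
Hypothesis S_sub : add_subgroup S.

Lemma add_subgroupN (X : zmodType) (H : set X) x : add_subgroup H -> H x -> H (- x).
Proof. by move=> [H0 HB] Hx; rewrite -sub0r; apply: HB. Qed.

Lemma add_subgroupD (X : zmodType) (H : set X) x y : add_subgroup H -> H x -> H y -> H (x + y).
Proof. by move=> Hs Hx Hy; rewrite -[y]opprK; apply: Hs.2 => //; apply: add_subgroupN. Qed.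

Lemma add_subgroup_image (X Y : zmodType) (h : {additive X -> Y}) (H : set X) :
  add_subgroup H -> add_subgroup (h @` H).
Proof.
move=> [H0 HB]; split; first by exists 0; rewrite ?raddf0.
by move=> _ _ [x Hx <-] [y Hy <-]; exists (x - y); [apply: HB | rewrite raddfB].
Qed.

Lemma add_subgroup_kernel (X Y : zmodType) (h : {additive X -> Y}) (H : set X) :
  add_subgroup H -> add_subgroup (H `&` [set x | h x = 0]).
Proof.
move=> [H0 HB]; split; first by split=> //=; rewrite raddf0.
by move=> x y [Hx /= hx] [Hy /= hy]; split; [apply: HB | rewrite /= raddfB hx hy subrr].
Qed.

Lemma add_sets_coset (X : zmodType) (H : set X) x y : add_subgroup H ->
  add_sets (add_coset H x) (add_coset H y) = add_coset H (x + y).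
Proof.
move=> Hs; apply/seteqP; split=> [_ [_ [h Hh <-]] [_ [k Hk <-]] <-|_ [h Hh <-]].
  by exists (h + k); [apply: add_subgroupD | rewrite addrACA].
exists (x + h); first by exists h.
by exists (y + 0); [exists 0; rewrite ?addr0 //; apply: Hs.1 | rewrite addr0 addrAC].
Qed.
End QuotientImages.

(** The correspondence a q -> b q acts on whole cosets, which avoids choosing preimages in S;
    exchanging a and b gives its inverse on cosets. *)
Definition transfer (W V V' : zmodType) (a : W -> V) (b : W -> V') (S : set W) (X : set V) :
  set V' := [set b q | q in S `&` [set q | X (a q)]].

(** If a r = a q + a k with b k = 0, then r - q - k lies in the kernel of a and b maps it to b r - b
    q. *)
Lemma transfer_coset (W V V' : zmodType) (a : {additive W -> V}) (b : {additive W -> V'})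
    (S : set W) q : add_subgroup S -> S q ->
  transfer a b S (add_coset (a @` (S `&` [set x | b x = 0])) (a q)) =
  add_coset (b @` (S `&` [set x | a x = 0])) (b q).
Proof.
move=> Ss Sq; apply/seteqP; split=> [_ [r [Sr /= [_ [k [Sk /= bk] <-] ar]] <-]|_ [_ [n [Sn /= an] <-] <-]].
  exists (b (r - q - k)); last by rewrite !raddfB bk subr0 addrC subrK.
  exists (r - q - k) => //; split; first by apply: Ss.2 => //; apply: Ss.2.
  by rewrite /= !raddfB -ar addrAC addrK subrr.
exists (q + n); last by rewrite raddfD.
split; first exact: add_subgroupD.
exists (a 0); first by exists 0 => //; split; [apply: Ss.1 | rewrite /= raddf0].
by rewrite raddfD an raddf0.
Qed.

(* Both quotients are S / (S \cap ker a + S \cap ker b). *)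
Lemma quotient_iso_images (W V V' : zmodType) (a : {additive W -> V}) (b : {additive W -> V'})
    (S : set W) : add_subgroup S ->
  quotient_iso (a @` S) (a @` (S `&` [set x | b x = 0]))
               (b @` S) (b @` (S `&` [set x | a x = 0])) (transfer a b S).
Proof.
move=> Ss.
have sub (V1 V2 : zmodType) (h : {additive W -> V1}) (k : {additive W -> V2}) :
    [/\ add_subgroup (h @` S), add_subgroup (h @` (S `&` [set x | k x = 0])) &
        h @` (S `&` [set x | k x = 0]) `<=` h @` S].
  split; [exact: add_subgroup_image| |by move=> _ [x [Sx _] <-]; exists x].
  exact/add_subgroup_image/add_subgroup_kernel.
split; first exact: sub; split; first exact: sub.
split; first split.
- by move=> _ [_ [q Sq <-] <-]; rewrite transfer_coset //; exists (b q); first by exists q.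
- move=> X Y; rewrite !inE => -[_ [q Sq <-] <-] [_ [r Sr <-] <-].
  rewrite !transfer_coset // => /(congr1 (transfer b a S)).
  by rewrite !(transfer_coset b a).
- move=> _ [_ [q Sq <-] <-]; exists (add_coset (a @` (S `&` [set x | b x = 0])) (a q)).
    by exists (a q) => //; exists q.
  by rewrite transfer_coset.
move=> _ _ [_ [q Sq <-] <-] [_ [r Sr <-] <-].
have [_ aH _] := sub _ _ a b; have [_ bH _] := sub _ _ b a.
rewrite add_sets_coset // -raddfD !transfer_coset // ?add_sets_coset -?raddfD //.
exact: add_subgroupD.
Qed.

(** * Points over U and M, and the unramified part *)

Section Main.
Variables (R : realType) (K : fieldType) (Kb : closedFieldType).
Variables (iota : {rmorphism K -> Kb}) (v : Kb -> R) (p : nat).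
Hypothesis Kb_alg : forall x, algebraicOver iota x.
Hypothesis K_char0 : [pchar K] =i pred0.
Hypotheses (va : nonarch_absv v) (p_prime : prime p) (vp : v p%:R < 1).
Hypothesis v_gal : forall s x, absgal (base_field iota) s -> v (s x) = v x.
Hypothesis res_alg : forall x, v x <= 1 -> resalg v p x.
Hypothesis K_discrete : discrete_on v (base_field iota).
Local Notation auto := {rmorphism Kb -> Kb}.
Local Notation base := (base_field iota).
Local Notation G_K := (absgal base).
Local Notation U := (unr_closure p base).
Implicit Types (s t g h : auto).
Variables (A A' : abelian_variety iota) (phi : {additive A -> A'}).
Hypothesis phi_isogeny : isogeny phi.
Local Notation T := (ker_pts phi).
Local Notation L := (adjoin_pts T).
Variables (L' M : set Kb) (m : nat) (tau : auto).
Hypothesis L'_max : max_unramified iota v L L'.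
Hypothesis m_exponent : has_exponent (rational_ker phi base) m.
Hypothesis M_unramified : unramified iota v L' M.
Hypothesis M_degree : has_degree L' M m.
Hypothesis tau_gen : generates_gal base M tau.

Lemma U_subext : subext iota U.
Proof. exact: unr_closure_subext (subext_base_field iota). Qed.

Lemma M_subext : subext iota M. Proof. by case: M_unramified. Qed.

Lemma L'_sub_M : L' `<=` M. Proof. by case: M_unramified. Qed.

Lemma M_sub_U : M `<=` U.
Proof.
apply: (unramified_sub_closure Kb_alg K_char0 va p_prime vp v_gal res_alg K_discrete).
have [[_ _ _ L'v] _ _] := L'_max; have [_ _ _ Mv] := M_unramified.
split; [exact: subext_base_field|exact: M_subext|exact: base_sub_subext M_subext|].
by move=> x /Mv [y /L'v [z Kz <-] <-]; exists z.
Qed.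

(** As M lies in U and Gal(U/K) is commutative, an automorphism fixing x also fixes s x. *)
Lemma M_normal s x : G_K s -> M x -> M (s x).
Proof.
move=> sG Mx; apply: (fixed_absgal Kb_alg K_char0 M_subext) => g gM.
have gG := absgal_base M_subext gM.
rewrite (absgal_unr_comm K_char0 va p_prime vp v_gal gG sG (M_sub_U Mx)).
by rewrite gM.2.
Qed.

Lemma M_tau_fixed x : M x -> tau x = x -> base x.
Proof.
move=> Mx tx; apply: (fixed_absgal Kb_alg K_char0 (subext_base_field iota)) => s sG.
have [_ /(_ s sG) [k ->]] := tau_gen; last exact: Mx.
by elim: k => //= k ->.
Qed.

Lemma rational_M_act (B : abelian_variety iota) s (P : B) :
  G_K s -> rational_pts M P -> rational_pts M (av_act s P).
Proof. by move=> sG PM i; rewrite av_act_coords //; apply: M_normal. Qed.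

Lemma rational_M_tau (B : abelian_variety iota) (P : B) :
  rational_pts M P -> av_act tau P = P -> rational_pts base P.
Proof.
move=> PM tP i; apply: M_tau_fixed; first exact: PM.
by rewrite -av_act_coords ?tP //; case: tau_gen.
Qed.

Lemma unr_level_seq (xs : seq Kb) : (forall x, x \in xs -> U x) ->
  exists2 r, (0 < r)%N & forall x, x \in xs -> unr_level p base r x.
Proof.
elim: xs => [|x xs IH] xsU; first by exists 1%N.
have [|r r0 Hr] := IH; first by move=> y y_xs; apply: xsU; rewrite inE y_xs orbT.
have [r' r'0 xr'] := xsU x (mem_head _ _).
exists (r * r')%N; first by rewrite muln_gt0 r0.
move=> y; rewrite inE => /orP [/eqP ->|/Hr]; last exact: unr_level_dvd.
by rewrite mulnC; apply: unr_level_dvd.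
Qed.

Lemma kummer_ker s Q : G_K s -> rational_pts base (phi Q) -> T (kummer Q s).
Proof.
move=> sG PK; rewrite /ker_pts /= /kummer raddfB isogeny_act //.
by rewrite (rational_act (subext_base_field iota) sG PK) subrr.
Qed.

Lemma rational_U_act s (P : A) : G_K s -> rational_pts U P -> rational_pts U (av_act s P).
Proof.
move=> sG PU i; rewrite av_act_coords //.
by apply: unr_closure_normal => //; apply: PU.
Qed.

(* sQ - Q is fixed by Gal(Kb / K) for s in Gal(Kb / L'), because Gal(U / K) is commutative and
   A(U)[phi] = A(L')[phi]. *)
Lemma kummer_rational s Q : absgal L' s -> rational_pts U Q -> rational_pts base (phi Q) ->
  rational_ker phi base (kummer Q s).
Proof.
move=> sL' QU PK; have L's := L'_subext L'_max; have sG := absgal_base L's sL'.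
have kumL' g : G_K g -> rational_pts L' (kummer Q g).
  move=> gG; apply: rational_pts_sub (L_U_sub_L' Kb_alg K_char0 va p_prime vp v_gal L'_max) _ _.
  move=> i; split; first exact: (ker_rational_L (kummer_ker gG PK)).
  by apply: (rational_ptsB Kb_alg K_char0 U_subext _ QU); apply: rational_U_act.
split; last exact: kummer_ker.
apply: (act_rational Kb_alg K_char0 (subext_base_field iota)) => g gG.
have e1 : av_act g (av_act s Q) = av_act s (av_act g Q).
  apply: av_coords_inj => i; rewrite !av_act_coords //.
  exact: (absgal_unr_comm K_char0 va p_prime vp v_gal gG sG (QU i)).
have gQ : av_act g Q = kummer Q g + Q by rewrite /kummer subrK.
rewrite {1}/kummer av_actB // e1 gQ av_actD // (rational_act L's sL' (kumL' g gG)).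
by rewrite opprD addrACA subrr add0r.
Qed.

Lemma rational_U_M Q : rational_pts U Q -> rational_pts base (phi Q) -> rational_pts M Q.
Proof.
move=> QU PK; have L's := L'_subext L'_max.
have [b [bM bspan _]] := M_degree.
(* A single level r contains both the basis of M / L' and the coordinates of Q, and at that level
   the action of Gal(Kb/L') is cyclic. *)
pose xs := [seq b i | i <- enum 'I_m] ++ [seq coords (av_emb Q) i | i <- enum 'I_(av_dim A).+1].
have [|r r0 xsr] := @unr_level_seq xs.
  move=> x; rewrite mem_cat => /orP [] /mapP [i _ ->]; last exact: QU.
  exact: M_sub_U.
have br i : unr_level p base r (b i).
  by apply: xsr; rewrite mem_cat map_f // mem_enum.
have Qr i : unr_level p base r (coords (av_emb Q) i).
  by apply: xsr; rewrite mem_cat orbC map_f // mem_enum.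
have [s0 [s0L' s0_gen]] := absgal_mu_cyclic K_char0 va p_prime vp v_gal L's r0.
have b_fix s t : absgal L' s -> absgal L' t -> (forall i, s (b i) = t (b i)) ->
    forall x, M x -> s x = t x.
  move=> sL' tL' st x /bspan [c cL' ->]; rewrite !rmorph_sum; apply: eq_bigr => i _.
  by rewrite !rmorphM st (sL'.2 _ (cL' i)) (tL'.2 _ (cL' i)).
have gen s : absgal L' s -> exists k t, [/\ absgal L' t, (forall x, t x = iter k s0 x) &
    forall x, unr_level p base r x -> s x = t x].
  move=> sL'; have [k Hk] := s0_gen s sL'; have [t [tL' tP]] := absgal_iter k s0L'.
  exists k, t; split=> // x; apply: unr_level_agree; [exact: absgal_base L's sL'|exact: absgal_base L's tL'|].
  by move=> z zr; rewrite tP Hk.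
have gen_M s : absgal L' s -> exists k, forall x, M x -> s x = iter k s0 x.
  move=> sL'; have [k [t [tL' tP st]]] := gen s sL'; exists k => x Mx.
  by rewrite -tP; apply: (b_fix s t) => // i; apply: st.
apply: (act_rational Kb_alg K_char0 M_subext) => g gM.
have gL' : absgal L' g by apply: absgal_sub gM; apply: L'_sub_M.
have [k [t [tL' tP gt]]] := gen g gL'.
(* The power t of s0 agrees with g on the basis of M, and g is trivial on M. *)
have mk : (m %| k)%N.
  apply: (cyclic_degree_dvd Kb_alg K_char0 L's M_subext M_degree s0L' gen_M) => x Mx.
  by rewrite -tP -(b_fix g t) // ?gM.2 // => i; apply: gt.
have kum := kummer_rational s0L' QU PK.
have s0G := absgal_base L's s0L'.
(* The point s0 Q - Q is rational over K, hence fixed by s0, so each application of s0 adds it once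
   more. *)
have tQ : av_act t Q = Q + kummer Q s0 *+ k.
  elim: k t tL' tP {gt mk} => [|k IH] t tL' tP.
    rewrite addr0 -[RHS]av_act_id; apply: av_act_eq; [exact: absgal_base L's tL'|exact: absgal_id|].
    by move=> i; rewrite tP.
  have [t' [t'L' t'P]] := absgal_iter k s0L'; have t'G := absgal_base L's t'L'.
  have -> : av_act t Q = av_act s0 (av_act t' Q).
    rewrite -av_act_comp //; apply: av_act_eq; [exact: absgal_base L's tL'|exact: absgal_comp|].
    by move=> i /=; rewrite tP t'P.
  rewrite (IH t') // av_actD // -[av_act s0 Q](subrK Q) -/(kummer Q s0).
  have -> : av_act s0 (kummer Q s0 *+ k) = kummer Q s0 *+ k.
    elim: (k) => [|l IHl]; first by rewrite mulr0n av_act0.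
    by rewrite mulrS av_actD // IHl (rational_act (subext_base_field iota) s0G kum.1).
  by rewrite mulrS addrA [_ + Q]addrC.
have -> : av_act g Q = av_act t Q.
  apply: av_act_eq; [exact: absgal_base L's gL'|exact: absgal_base L's tL'|] => i; exact: gt.
rewrite tQ; have [_ mkill _] := m_exponent; have /dvdnP [l ->] := mk.
by rewrite mulnC mulrnA mkill // mul0rn addr0.
Qed.

Lemma unramified_part_M P : H1_trivial L' L T -> unramified_part phi v L P ->
  exists2 Q, rational_pts M Q & phi Q = P.
Proof.
move=> H1 [PK [Q [QP _ Qu]]]; rewrite -QP in PK.
have [a Ta Qa] := kummer_inertia_split Kb_alg K_char0 va p_prime vp v_gal res_alg K_discrete
  phi_isogeny L'_max H1 PK Qu.
have QaP : phi (Q - a) = P by rewrite raddfB Ta subr0.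
exists (Q - a) => //; apply: rational_U_M; last by rewrite QaP -QP.
apply: (act_rational Kb_alg K_char0 U_subext) => h hU; apply: Qa.
exact: inertia_absgal_U hU.
Qed.

Lemma M_unramified_part Q : rational_pts M Q -> rational_pts base (phi Q) ->
  unramified_part phi v L (phi Q).
Proof.
move=> QM PK; split=> //; exists Q.
have Ls := L_subext phi; have LG s : absgal L s -> G_K s := absgal_base Ls.
split=> //; first split.
- by move=> s /LG sG; apply: kummer_ker.
- move=> s t sL tL; have sG := LG s sL; have tG := LG t tL.
  rewrite /kummer av_act_comp //; have tT := kummer_ker tG PK.
  have := absgal_L_ker sL tT; rewrite /kummer av_actB // => <-.
  by rewrite [RHS]addrC addrA subrK.
- move=> s sL; exists [seq coords (av_emb Q) i | i <- enum 'I_(av_dim A).+1] => t tL ts.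
  rewrite /kummer (av_act_eq (s := t) (t := s)) //; try exact: LG.
  by move=> i; apply: ts; rewrite map_f // mem_enum.
- move=> g s t gG sL tL tg; have sG := LG s sL; have tG := LG t tL.
  have e1 : av_act g (av_act s Q) = av_act t (av_act g Q).
    by apply: av_coords_inj => i; rewrite !av_act_coords.
  have gQ : av_act g Q = kummer Q g + Q by rewrite /kummer subrK.
  rewrite /kummer av_actB // e1 gQ av_actD // (absgal_L_ker tL (kummer_ker gG PK)).
  by rewrite opprD addrACA subrr add0r.
exists (unr_closure p L); split.
- exact: (unr_closure_unramified Kb_alg K_char0 va p_prime vp v_gal Ls).
- exact: unr_closure_normal.
move=> s t sL tL st; rewrite /kummer (av_act_eq (s := s) (t := t)) //; try exact: LG.
move=> i; apply: st; have [r r0 Qr] := M_sub_U (QM i); exists r => // h hL; apply: Qr.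
exact: LG.
Qed.

Lemma unramified_part_iso : H1_trivial L' L T ->
  exists f : set A' -> set A,
    quotient_iso
      (unramified_part phi v L) (phi @` rational_pts base)
      (rational_ker phi M `&` act_sub1 tau (rational_pts M))
      (act_sub1 tau (rational_ker phi M)) f /\
    (forall P, unramified_part phi v L P -> exists2 Q, rational_pts M Q & phi Q = P) /\
    (forall P Q, unramified_part phi v L P -> rational_pts M Q -> phi Q = P ->
       f (add_coset (phi @` rational_pts base) P) =
       add_coset (act_sub1 tau (rational_ker phi M)) (av_act tau Q - Q)).
Proof.
move=> H1; have [tauG _] := tau_gen.
pose D0 (Q : A) := av_act tau Q - Q.
have D0_zmod : zmod_morphism D0.
  by move=> P Q; rewrite /D0 av_actB // !opprB addrACA [RHS]addrACA [X in _ = _ + X]addrC.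
pose D : {additive A -> A} := HB.pack D0 (GRing.isZmodMorphism.Build A A D0 D0_zmod).
(* For Q in A(M), the vanishing of phi (D Q) = tau (phi Q) - phi Q says that phi Q is fixed by tau,
   that is, rational over K. *)
pose S : set A := [set Q | rational_pts M Q /\ phi (D Q) = 0].
have phiD Q : phi (D Q) = av_act tau (phi Q) - phi Q by rewrite raddfB isogeny_act.
have S_sub : add_subgroup S.
  split; first by split; [apply: rational_pts0 M_subext | rewrite !raddf0].
  move=> P Q [PM P0] [QM Q0]; split; last by rewrite (raddfB D) (raddfB phi) P0 Q0 subrr.
  exact: rational_ptsB M_subext PM QM.
have K_M : base `<=` M by apply: base_sub_subext M_subext.
have fix_tau (B : abelian_variety iota) (P : B) : rational_pts base P -> av_act tau P = P.
  exact: rational_act (subext_base_field iota) tauG.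
have S_K Q : S Q -> rational_pts base (phi Q).
  move=> [QM Q0]; apply: rational_M_tau; last by apply/eqP; rewrite -subr_eq0 -phiD Q0.
  apply: (act_rational Kb_alg K_char0 M_subext) => g gM.
  by rewrite -isogeny_act ?(rational_act M_subext gM QM) //; apply: absgal_base M_subext gM.
have M_S Q : rational_pts M Q -> rational_pts base (phi Q) -> S Q.
  by move=> QM QK; split=> //; rewrite phiD fix_tau // subrr.
(* The equalities [E1] to [E4] put both quotients in the form of [quotient_iso_images]; for Q in
   A(M), D Q = 0 means that Q is rational over K. *)
have E1 : unramified_part phi v L = phi @` S.
  apply/seteqP; split=> [P Pu|_ [Q SQ <-]]; last by apply: M_unramified_part (S_K Q SQ); case: SQ.
  have [Q QM QP] := unramified_part_M H1 Pu; exists Q => //; apply: M_S => //.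
  by rewrite QP; case: Pu.
have E2 : phi @` rational_pts base = phi @` (S `&` [set x | D x = 0]).
  apply/seteqP; split=> w [Q].
    move=> QK <-; exists Q => //; have DQ : D Q = 0 by rewrite /D /= /D0 fix_tau // subrr.
    by split=> //; split; [apply: rational_pts_sub K_M _ QK | rewrite DQ raddf0].
  move=> [[QM _] DQ] <-; exists Q => //; apply: rational_M_tau => //.
  by apply/eqP; rewrite -subr_eq0; apply/eqP.
have E3 : rational_ker phi M `&` act_sub1 tau (rational_pts M) = D @` S.
  apply/seteqP; split=> [w [[_ w0] [Q QM e]]|w [Q [QM Q0] <-]].
    by exists Q => //; split=> //; rewrite /D /= /D0 e.
  split; last by exists Q.
  by split=> //; apply: (rational_ptsB Kb_alg K_char0 M_subext (rational_M_act tauG QM) QM).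
have E4 : act_sub1 tau (rational_ker phi M) = D @` (S `&` [set x | phi x = 0]).
  apply/seteqP; split=> w [Q].
    move=> [QM Q0] <-; exists Q => //; split=> //; apply: M_S => //.
    by rewrite Q0; apply: (rational_pts0 Kb_alg K_char0 (subext_base_field iota)).
  by move=> [[QM _] Q0] <-; exists Q.
exists (transfer phi D S); split; first by rewrite E1 E2 E3 E4; apply: quotient_iso_images.
split; first by move=> P; apply: unramified_part_M.
move=> P Q [PK _] QM QP; rewrite E2 E4 -QP; apply: transfer_coset => //.
by apply: M_S; rewrite ?QP.
Qed.
End Main.

Unset Implicit Arguments.

Theorem theorem3p4 (R : realType) (F : fieldExtType rat) (vF : F -> R)
    (K : fieldType) (vK : K -> R) (j : {rmorphism F -> K})
    (Kb : closedFieldType) (iota : {rmorphism K -> Kb}) (v : Kb -> R)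
    (A A' : abelian_variety iota) (phi : {additive A -> A'})
    (L L' M : set Kb) (m : nat) (tau : {rmorphism Kb -> Kb})
    (vF_prime : finite_prime vF)
    (K_completion : is_completion vF vK j)
    (Kb_algebraic : forall x, algebraicOver iota x)
    (v_absv : nonarch_absv v)
    (v_ext : forall x, v (iota x) = vK x)
    (phi_isogeny : isogeny phi)
    (L_def : L = adjoin_pts (ker_pts phi))
    (L'_max : max_unramified iota v L L')
    (m_exponent : has_exponent (rational_ker phi (base_field iota)) m)
    (M_unramified : unramified iota v L' M)
    (M_degree : has_degree L' M m)
    (tau_gen : generates_gal (base_field iota) M tau)
    (H1_0 : H1_trivial L' L (ker_pts phi)) :
  exists f : set A' -> set A,
    quotient_iso
      (unramified_part phi v L) (phi @` rational_pts (base_field iota))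
      (rational_ker phi M `&` act_sub1 tau (rational_pts M))
      (act_sub1 tau (rational_ker phi M)) f /\
    (forall P, unramified_part phi v L P -> exists2 Q, rational_pts M Q & phi Q = P) /\
    (forall P Q, unramified_part phi v L P -> rational_pts M Q -> phi Q = P ->
       f (add_coset (phi @` rational_pts (base_field iota)) P) =
       add_coset (act_sub1 tau (rational_ker phi M)) (av_act tau Q - Q)).
Proof.
subst L; have K_char0 := local_char0 j.
have [p p_prime vp] := residue_char vF_prime K_completion v_absv v_ext.
have res_alg x : v x <= 1 -> resalg v p x.
  exact: (local_resalg K_completion Kb_algebraic v_absv v_ext p_prime vp).
have v_gal s x : absgal (base_field iota) s -> v (s x) = v x.
  exact: (local_galois K_completion Kb_algebraic v_absv v_ext).
apply: (unramified_part_iso Kb_algebraic K_char0 v_absv p_prime vp v_gal res_alg _ phi_isogeny L'_max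
  m_exponent M_unramified M_degree tau_gen H1_0).
exists (\dim {:F}), (v p%:R); split=> //; [exact: adim_gt0 | exact: absv_ge0 |].
move=> _ [y _ <-]; apply: (local_discrete K_completion v_absv v_ext p_prime vp).
Qed.
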